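(* Let $f\colon [0,\infty)\to\mathbb{R}$ be a real analytic function (analytic on $[0,\infty)$, including at the endpoint $0$) such that the set $$U=\{u>0 : (f(ku))_{k\geq 1}\in \mathcal{G}\}$$ is uncountable. Then $f$ is a polynomial.
   Context: A sequence of real numbers $(a_k)_{k\ge1}$ is called pointwise good (written $(a_k)\in\mathcal{G}$) if for every measure preserving flow $(U_t)_{t\in\mathbb{R}}$ on a probability space $(X,\mathcal{B},\mu)$ (a measurable action of $\mathbb{R}$ by measure preserving transformations) and every $F\in L^\infty(X,\mu)$, the averages $\frac1n\sum_{k=1}^n F(U_{a_k}x)$ converge for $\mu$-almost every $x$ as $n\to\infty$. *)

(* Defs.v *)
From Stdlib Require Import Reals.
Open Scope R_scope.

Definition is_sigma_algebra {X : Type} (B : (X -> Prop) -> Prop) : Prop :=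
  B (fun _ => True) /\
  (forall A, B A -> B (fun x => ~ A x)) /\
  (forall An : nat -> X -> Prop, (forall n, B (An n)) ->
     B (fun x => exists n, An n x)).

Definition generated_sigma {X : Type} (G : (X -> Prop) -> Prop) (A : X -> Prop) : Prop :=
  forall B : (X -> Prop) -> Prop, is_sigma_algebra B -> (forall S, G S -> B S) -> B A.

Definition borel (A : R -> Prop) : Prop :=
  generated_sigma (fun S => exists a b : R, forall x, S x <-> (a < x /\ x < b)) A.

Definition borel_prod {X : Type} (B : (X -> Prop) -> Prop) (A : R * X -> Prop) : Prop :=
  generated_sigma
    (fun S => exists (A1 : R -> Prop) (C : X -> Prop), borel A1 /\ B C /\
        forall p, S p <-> (A1 (fst p) /\ C (snd p))) A.

Definition is_probability_space {X : Type} (B : (X -> Prop) -> Prop)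
    (mu : (X -> Prop) -> R) : Prop :=
  is_sigma_algebra B /\
  (forall A, B A -> 0 <= mu A) /\
  mu (fun _ => True) = 1 /\
  (forall An : nat -> X -> Prop,
     (forall n, B (An n)) ->
     (forall n m x, n <> m -> An n x -> An m x -> False) ->
     Un_cv (fun N => sum_f_R0 (fun n => mu (An n)) N) (mu (fun x => exists n, An n x))).

Definition is_mp_flow {X : Type} (B : (X -> Prop) -> Prop) (mu : (X -> Prop) -> R)
    (U : R -> X -> X) : Prop :=
  (forall C, B C -> borel_prod B (fun p => C (U (fst p) (snd p)))) /\
  (forall x, U 0 x = x) /\
  (forall s t x, U (s + t) x = U s (U t x)) /\
  (forall t C, B C -> B (fun x => C (U t x)) /\ mu (fun x => C (U t x)) = mu C).

Definition is_Linfty {X : Type} (B : (X -> Prop) -> Prop) (mu : (X -> Prop) -> R)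
    (F : X -> R) : Prop :=
  (forall A, borel A -> B (fun x => A (F x))) /\
  exists M : R, exists N : X -> Prop, B N /\ mu N = 0 /\
     forall x, ~ N x -> Rabs (F x) <= M.

(** Ergodic average (1/n) * sum_{k=1}^n F (U_{a_k} x), indexed so that
    [erg_avg a U F x n] is the average with n+1 terms. The sequence
    (a_k)_{k>=1} is represented by a : nat -> R whose value at 0 is unused. *)
Definition erg_avg {X : Type} (a : nat -> R) (U : R -> X -> X) (F : X -> R)
    (x : X) (n : nat) : R :=
  / INR (S n) * sum_f_R0 (fun i => F (U (a (S i)) x)) n.

Definition pointwise_good (a : nat -> R) : Prop :=
  forall (X : Type) (B : (X -> Prop) -> Prop) (mu : (X -> Prop) -> R)
         (U : R -> X -> X) (F : X -> R),
    is_probability_space B mu -> is_mp_flow B mu U -> is_Linfty B mu F ->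
    exists N : X -> Prop, B N /\ mu N = 0 /\
      forall x, ~ N x -> exists l : R, Un_cv (erg_avg a U F x) l.

Definition real_analytic_on_nonneg (f : R -> R) : Prop :=
  forall x0, 0 <= x0 -> exists r, 0 < r /\ exists c : nat -> R,
    forall x, 0 <= x -> Rabs (x - x0) < r ->
      Un_cv (fun n => sum_f_R0 (fun i => c i * (x - x0) ^ i) n) (f x).

Definition is_polynomial_on_nonneg (f : R -> R) : Prop :=
  exists (n : nat) (c : nat -> R), forall x, 0 <= x -> f x = sum_f_R0 (fun i => c i * x ^ i) n.

Definition uncountable (A : R -> Prop) : Prop :=
  ~ exists g : R -> nat, forall u v, A u -> A v -> g u = g v -> u = v.

(* Main.v *)
Require Import Defs.
From HB Require structures.
From mathcomp Require all_boot all_order all_algebra.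
From mathcomp Require boolp classical_sets reals ereal normedtype measure lebesgue_measure
  measurable_realfun Rstruct.
From Stdlib Require Import Reals Lra Lia ZArith List Classical ClassicalEpsilon.
From Stdlib Require Import IndefiniteDescription FunctionalExtensionality PropExtensionality Cantor.
Open Scope R_scope.

(** Integer relations. If [f] is analytic and not a polynomial, then for every nontrivial integer
    vector [z] the function [u |-> sum_k z_k f ((k+1) u)] is analytic and not identically zero
    (compare Taylor coefficients at 0: [sum_k z_k (k+1)^j] is nonzero for large [j]), hence has
    isolated zeros. So [f(u), f(2u), ...] is linearly independent over the rationals for all but
    countably many [u].

    Independent sequences are bad. Let [a_1, a_2, ...] be independent and choose [lam > 0] such that
    [1, lam a_1, lam a_2, ...] is independent; let [t] rotate the circle by [lam t]. Given [m], Kronecker's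
    theorem yields an integer [s] for which [s lam a_k] is close to [- i / (4m)] modulo 1 when [k] lies
    in the [i]-th of [4m] successive blocks of doubling length. Then each point spends half of the time
    until the end of some block in the set where [s x] is within [1/(2m)] of an integer, a set of
    measure [1/m]. A union of such sets over rapidly growing [m] has measure at most 1/8, but its
    ergodic averages exceed 1/2 infinitely often at every point. If they converged almost everywhere,
    Markov's inequality would be violated. *)

(** * Analytic functions and integer relations *)

Lemma Un_cv_ext (u v : nat -> R) l :
  (forall n, u n = v n) -> Un_cv u l -> Un_cv v l.
Proof.
  intros H Hu e He; destruct (Hu e He) as [N HN]; exists N; intros n Hn.
  rewrite <- H; auto.
Qed.

Lemma Un_cv_const c : Un_cv (fun _ => c) c.
Proof.
  intros e He; exists 0%nat; intros; unfold Rdist; rewrite Rminus_diag, Rabs_R0; lra.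
Qed.

Lemma Un_cv_le_const u l M N : Un_cv u l -> (forall n, (N <= n)%nat -> u n <= M) -> l <= M.
Proof.
  intros Hu HM. apply Rnot_lt_le; intro H.
  destruct (Hu (l - M)) as [n0 Hn]; [lra|].
  specialize (Hn (max N n0) ltac:(lia)). specialize (HM (max N n0) ltac:(lia)).
  unfold Rdist in Hn; apply Rabs_def2 in Hn; lra.
Qed.

(* Power series centred at [x0], evaluated only on [0, oo): at [x0 = 0] this is one-sided. *)
Definition analytic_at (f : R -> R) (x0 : R) : Prop :=
  exists r, 0 < r /\ exists c : nat -> R,
    forall x, 0 <= x -> Rabs (x - x0) < r ->
      Un_cv (fun n => sum_f_R0 (fun i => c i * (x - x0) ^ i) n) (f x).

Lemma analytic_at_add f g x0 :
  analytic_at f x0 -> analytic_at g x0 -> analytic_at (fun x => f x + g x) x0.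
Proof.
  intros (r & Hr & c & Hc) (r' & Hr' & c' & Hc').
  exists (Rmin r r'); split; [apply Rmin_pos; auto|].
  exists (fun i => c i + c' i); intros x Hx Hd.
  pose proof (Rmin_l r r'); pose proof (Rmin_r r r').
  eapply Un_cv_ext; [|apply CV_plus; [apply Hc|apply Hc']; auto; lra].
  intros n; simpl; rewrite <- sum_plus; apply sum_eq; intros; ring.
Qed.

Lemma analytic_at_scal f a x0 :
  analytic_at f x0 -> analytic_at (fun x => a * f x) x0.
Proof.
  intros (r & Hr & c & Hc).
  exists r; split; auto; exists (fun i => a * c i); intros x Hx Hd.
  eapply Un_cv_ext; [|apply CV_mult; [apply (Un_cv_const a)|apply Hc; auto]].
  intros n; simpl; rewrite scal_sum; apply sum_eq; intros; ring.
Qed.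

Lemma analytic_at_const a x0 : analytic_at (fun _ => a) x0.
Proof.
  exists 1; split; [lra|]; exists (fun i => match i with O => a | _ => 0 end).
  intros x _ _; eapply Un_cv_ext; [|apply (Un_cv_const a)].
  intros n; induction n; simpl in *; [ring|rewrite <- IHn; ring].
Qed.

Lemma analytic_at_mulX f x0 :
  analytic_at f x0 -> analytic_at (fun x => x * f x) x0.
Proof.
  intros (r & Hr & c & Hc).
  exists r; split; auto.
  exists (fun i => match i with O => x0 * c O | S j => c j + x0 * c (S j) end).
  intros x Hx Hd; specialize (Hc x Hx Hd).
  replace (x * f x) with ((x - x0) * f x + x0 * f x) by ring.
  apply CV_shift with (k := 1%nat).
  eapply Un_cv_ext; [|apply CV_plus; apply CV_mult].
  2: apply (Un_cv_const (x - x0)). 2: exact Hc. 2: apply (Un_cv_const x0).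
  2: exact (CV_shift' _ 1 _ Hc).
  intros n; cbv beta; rewrite Nat.add_1_r.
  induction n; simpl in *; [ring|].
  rewrite <- IHn; ring.
Qed.

Lemma analytic_at_dilate f m x0 : 0 < m -> 0 <= x0 ->
  analytic_at f (m * x0) -> analytic_at (fun x => f (m * x)) x0.
Proof.
  intros Hm Hx0 (r & Hr & c & Hc).
  exists (r / m); split; [apply Rdiv_lt_0_compat; auto|].
  exists (fun i => c i * m ^ i); intros x Hx Hd.
  eapply Un_cv_ext; [|apply Hc; [nra|]].
  - intros n; apply sum_eq; intros i _.
    replace (m * x - m * x0) with (m * (x - x0)) by ring.
    rewrite Rpow_mult_distr; ring.
  - replace (m * x - m * x0) with (m * (x - x0)) by ring.
    rewrite Rabs_mult, (Rabs_right m) by lra.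
    apply Rmult_lt_reg_l with (/ m); [apply Rinv_0_lt_compat; auto|].
    rewrite <- Rmult_assoc, Rinv_l, Rmult_1_l by lra.
    unfold Rdiv in Hd; lra.
Qed.

Lemma analytic_polynomial c n x0 :
  analytic_at (fun x => sum_f_R0 (fun i => c i * x ^ i) n) x0.
Proof.
  assert (Hp : forall i, analytic_at (fun x => x ^ i) x0).
  { induction i; [exact (analytic_at_const 1 x0)|]. exact (analytic_at_mulX _ _ IHi). }
  induction n; simpl.
  - exact (analytic_at_scal _ _ _ (Hp 0%nat)).
  - apply analytic_at_add; auto. exact (analytic_at_scal _ _ _ (Hp (S n))).
Qed.

Lemma geometric_tail_bound q n m : 0 <= q <= / 2 ->
  sum_f_R0 (fun i => q ^ (i + m)) n <= 2 * q ^ m.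
Proof.
  intros Hq.
  (* The sharper bound keeps the room [(/2) ^ n] that the induction step consumes. *)
  assert (H : sum_f_R0 (fun i => q ^ (i + m)) n <= q ^ m * (2 - (/2) ^ n)).
  { assert (0 <= q ^ m) by (apply pow_le; lra).
    induction n; simpl; [nra|].
    assert (q ^ (n + m) <= (/2) ^ n * q ^ m).
    { rewrite pow_add. apply Rmult_le_compat_r; auto. apply pow_incr; lra. }
    assert (0 <= (/2)^n) by (apply pow_le; lra). simpl in IHn.
    assert (0 <= q ^ (n+m)) by (apply pow_le; lra).
    nra. }
  assert (0 <= (/2)^n) by (apply pow_le; lra).
  assert (0 <= q ^ m) by (apply pow_le; lra). nra.
Qed.

Lemma cv_terms_bounded (u : nat -> R) l :
  Un_cv (fun n => sum_f_R0 u n) l -> exists M, 0 < M /\ forall i, Rabs (u i) <= M.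
Proof.
  intros H. destruct (maj_by_pos _ (exist _ l H)) as (M & HM & Hb).
  exists (2 * M); split; [lra|]. intros [|i].
  - specialize (Hb 0%nat); simpl in Hb; lra.
  - replace (u (S i)) with (sum_f_R0 u (S i) - sum_f_R0 u i) by (simpl; ring).
    eapply Rle_trans; [apply Rabs_triang|]; rewrite Rabs_Ropp.
    pose proof (Hb (S i)); pose proof (Hb i); lra.
Qed.

(** Convergence at [t0] bounds all [c i * t0 ^ i] by some [M]. For [|t| <= t0 / 2] the terms beyond
    index [m] are then dominated by a geometric series of ratio at most 1/2. Convergence is asked
    only at the given [t], so the estimate also serves one-sided expansions. *)
Lemma power_series_leading (c : nat -> R) (h : R -> R) t0 m :
  0 < t0 -> Un_cv (fun n => sum_f_R0 (fun i => c i * t0 ^ i) n) (h t0) ->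
  (forall i, (i < m)%nat -> c i = 0) ->
  exists C, 0 < C /\ forall t, Rabs t <= t0 / 2 ->
    Un_cv (fun n => sum_f_R0 (fun i => c i * t ^ i) n) (h t) ->
    Rabs (h t - c m * t ^ m) <= C * Rabs t ^ S m.
Proof.
  intros Ht0 Hcv Hz.
  destruct (cv_terms_bounded _ _ Hcv) as (M & HM & HMb).
  exists (2 * M / t0 ^ S m).
  assert (Hpt : 0 < t0 ^ S m) by (apply pow_lt; auto).
  split; [apply Rdiv_lt_0_compat; lra|].
  intros t Ht Hc.
  set (q := Rabs t / t0).
  assert (Hq : 0 <= q <= / 2).
  { unfold q; split.
    - apply Rmult_le_pos; [apply Rabs_pos|left; apply Rinv_0_lt_compat; auto].
    - apply Rmult_le_reg_r with t0; auto. unfold Rdiv; rewrite Rmult_assoc, Rinv_l by lra. lra. }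
  assert (Hterm : forall i, Rabs (c i * t ^ i) <= M * q ^ i).
  { intros i; specialize (HMb i). rewrite Rabs_mult in HMb |- *.
    rewrite <- RPow_abs in HMb |- *. rewrite (Rabs_right t0) in HMb by lra.
    unfold q, Rdiv. rewrite Rpow_mult_distr, pow_inv.
    assert (0 < t0 ^ i) by (apply pow_lt; auto).
    replace (Rabs (c i) * Rabs t ^ i) with
      ((Rabs (c i) * t0 ^ i) * (Rabs t ^ i * / t0 ^ i)) by (field; lra).
    apply Rmult_le_compat_r; auto.
    apply Rmult_le_pos; [apply pow_le, Rabs_pos|left; apply Rinv_0_lt_compat; auto]. }
  assert (Hsplit : forall n, sum_f_R0 (fun i => c i * t ^ i) (n + S m)
      = c m * t ^ m + sum_f_R0 (fun i => c (i + S m)%nat * t ^ (i + S m)) n).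
  { assert (H0 : sum_f_R0 (fun i => c i * t ^ i) m = c m * t ^ m).
    { destruct m; [reflexivity|]. simpl.
      rewrite (sum_eq_R0 _ m); [ring|]. intros; rewrite Hz by lia; ring. }
    induction n; simpl plus in *.
    - change (sum_f_R0 (fun i => c i * t ^ i) m + c (S m) * t ^ S m =
        c m * t ^ m + c (S m) * t ^ S m). rewrite H0; ring.
    - change (sum_f_R0 (fun i => c i * t ^ i) (n + S m) +
         c (S (n + S m)) * t ^ S (n + S m)
        = c m * t ^ m + (sum_f_R0 (fun i => c (i + S m)%nat * t ^ (i + S m)) n
           + c (S (n + S m)) * t ^ S (n + S m))).
      rewrite IHn; ring. }
  replace (2 * M / t0 ^ S m * Rabs t ^ S m) with (M * (2 * q ^ S m)).
  2:{ unfold q, Rdiv; rewrite Rpow_mult_distr, pow_inv; ring. }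
  apply (CV_shift' _ (S m)) in Hc.
  assert (Hc' : Un_cv (fun n => Rabs (sum_f_R0 (fun i => c i * t ^ i) (n + S m) - c m * t ^ m))
     (Rabs (h t - c m * t ^ m))).
  { apply cv_cvabs. apply CV_minus; auto. apply Un_cv_const. }
  eapply Un_cv_le_const with (N := 0%nat); [exact Hc'|].
  intros n _; cbv beta. rewrite Hsplit.
  replace (c m * t ^ m + _ - _) with
    (sum_f_R0 (fun i => c (i + S m)%nat * t ^ (i + S m)) n) by ring.
  eapply Rle_trans; [apply Rsum_abs|].
  eapply Rle_trans; [apply sum_Rle; intros; apply Hterm|].
  eapply Rle_trans; [|apply Rmult_le_compat_l; [lra|apply (geometric_tail_bound q n (S m)); auto]].
  rewrite scal_sum. right; apply sum_eq; intros; ring.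
Qed.

Lemma first_nonzero (c : nat -> R) :
  (forall i, c i = 0) \/
  exists m, c m <> 0 /\ forall i, (i < m)%nat -> c i = 0.
Proof.
  destruct (classic (forall i, c i = 0)) as [|H]; [left; auto|right].
  apply not_all_ex_not in H as [n Hn].
  revert Hn; induction n as [n IH] using (well_founded_induction lt_wf); intros Hn.
  destruct (classic (forall i, (i < n)%nat -> c i = 0)) as [|H]; [exists n; auto|].
  apply not_all_ex_not in H as [i Hi]. apply imply_to_and in Hi as [Hi1 Hi2]; eauto.
Qed.

Lemma power_series_isolated (c : nat -> R) (h : R -> R) r x0 :
  0 < r -> 0 <= x0 ->
  (forall x, 0 <= x -> Rabs (x - x0) < r ->
      Un_cv (fun n => sum_f_R0 (fun i => c i * (x - x0) ^ i) n) (h x)) ->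
  (exists m, c m <> 0) ->
  exists d, 0 < d /\ forall x, 0 <= x -> Rabs (x - x0) < d -> x <> x0 -> h x <> 0.
Proof.
  intros Hr Hx0 Hc [m0 Hm0].
  destruct (first_nonzero c) as [H|(m & Hm & Hlt)]; [now specialize (H m0)|].
  set (t0 := r / 2).
  destruct (power_series_leading c (fun t => h (x0 + t)) t0 m) as (C & HC & Hb);
    unfold t0 in *; auto; [lra| |].
  { specialize (Hc (x0 + r / 2)). replace (x0 + r / 2 - x0) with (r / 2) in Hc by ring.
    apply Hc; [lra|]. rewrite Rabs_right; lra. }
  (* [r / 4] is half of [t0], as the estimate demands; the second bound makes the error
     [C * |x - x0| ^ S m] smaller than the leading term. *)
  set (d := Rmin (r / 4) (Rabs (c m) / C)).
  assert (0 < Rabs (c m)) by (apply Rabs_pos_lt; auto).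
  exists d; split.
  { apply Rmin_pos; [lra|apply Rdiv_lt_0_compat; auto]. }
  intros x Hx Hd Hne Heq.
  assert (d <= r / 4 /\ d <= Rabs (c m) / C) as [Hd1 Hd2]
    by (split; [apply Rmin_l|apply Rmin_r]).
  specialize (Hb (x - x0)). replace (x0 + (x - x0)) with x in Hb by ring.
  specialize (Hb ltac:(lra) (Hc x Hx ltac:(lra))).
  rewrite Heq in Hb. unfold Rminus at 1 in Hb. rewrite Rplus_0_l, Rabs_Ropp, Rabs_mult in Hb.
  rewrite <- RPow_abs in Hb. simpl in Hb.
  assert (0 < Rabs (x - x0)) by (apply Rabs_pos_lt; lra).
  assert (0 < Rabs (x - x0) ^ m) by (apply pow_lt; auto).
  assert (C * Rabs (x - x0) < Rabs (c m)).
  { apply Rlt_le_trans with (C * (Rabs (c m) / C)).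
    - apply Rmult_lt_compat_l; lra.
    - right; field; lra. }
  nra.
Qed.

Lemma power_series_zero (c : nat -> R) (h : R -> R) r x0 :
  (forall x, 0 <= x -> Rabs (x - x0) < r ->
      Un_cv (fun n => sum_f_R0 (fun i => c i * (x - x0) ^ i) n) (h x)) ->
  (forall i, c i = 0) ->
  forall x, 0 <= x -> Rabs (x - x0) < r -> h x = 0.
Proof.
  intros Hc Hz x Hx Hd. eapply UL_sequence; [apply Hc; auto|].
  eapply Un_cv_ext; [|apply (Un_cv_const 0)].
  intros n; symmetry; apply sum_eq_R0; intros; rewrite Hz; ring.
Qed.

(** * Zeros of analytic functions and the identity theorem *)

Definition vanishes_near (f : R -> R) x0 :=
  exists d, 0 < d /\ forall x, 0 <= x -> Rabs (x - x0) < d -> f x = 0.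

Lemma analytic_dichotomy f x0 : 0 <= x0 -> analytic_at f x0 ->
  vanishes_near f x0 \/
  exists d, 0 < d /\ forall x, 0 <= x -> Rabs (x - x0) < d -> x <> x0 -> f x <> 0.
Proof.
  intros Hx0 (r & Hr & c & Hc).
  destruct (classic (exists m, c m <> 0)) as [H|H].
  - right; eapply power_series_isolated; eauto.
  - left; exists r; split; auto. eapply power_series_zero; eauto.
    intros i; apply NNPP; intro; apply H; eauto.
Qed.

(** Connectedness of a segment. Let [T] be the supremum of the [t] such that [P] agrees with [P a]
    on all of [[a, t]]. Local constancy at [T] carries the agreement past [T], unless [T = b]. *)
Lemma locally_constant_segment (P : R -> Prop) a b : a <= b ->
  (forall x, a <= x <= b -> exists d, 0 < d /\
     forall y, a <= y <= b -> Rabs (y - x) < d -> (P y <-> P x)) ->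
  (P a <-> P b).
Proof.
  intros Hab Hloc.
  set (S := fun t => a <= t <= b /\ forall y, a <= y <= t -> (P y <-> P a)).
  destruct (completeness S) as [T [Hub Hlub]].
  { exists b; intros t [? _]; lra. }
  { exists a; split; [lra|]. intros y Hy; replace y with a by lra; tauto. }
  assert (HaT : a <= T).
  { apply Hub; split; [lra|]. intros y Hy; replace y with a by lra; tauto. }
  assert (HTb : T <= b) by (apply Hlub; intros t [? _]; lra).
  destruct (Hloc T) as (d & Hd & HdT); [lra|].
  assert (Ht : exists t, S t /\ T - d < t).
  { apply NNPP; intro H. assert (T <= T - d); [|lra].
    apply Hlub; intros t Ht. apply Rnot_lt_le; intro; apply H; exists t; auto. }
  destruct Ht as (t & [Ht1 Ht2] & Ht3).
  assert (t <= T) by (apply Hub; split; auto).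
  assert (HPT : P T <-> P a).
  { rewrite <- (Ht2 t) by lra. symmetry; apply HdT; [lra|].
    rewrite Rabs_left1; lra. }
  set (T' := Rmin b (T + d / 2)).
  assert (HT' : T' <= b /\ T' <= T + d / 2) by (split; [apply Rmin_l|apply Rmin_r]).
  assert (HTT' : T <= T') by (apply Rmin_glb; lra).
  assert (S T').
  { split; [lra|]. intros y Hy.
    destruct (Rle_dec y t); [apply Ht2; lra|].
    rewrite (HdT y); [auto|lra|]. apply Rabs_def1; lra. }
  assert (T' <= T) by (apply Hub; auto).
  assert (T = b).
  { apply Rle_antisym; auto. unfold T' in *; unfold Rmin in *; destruct Rle_dec; lra. }
  subst b; symmetry; auto.
Qed.

(** By the dichotomy, the property of vanishing near a point is locally constant: it spreads to
    nearby points, and it fails at every point near one with no other zeros around it. *)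
Lemma identity_theorem f u : (forall x0, 0 <= x0 -> analytic_at f x0) ->
  0 <= u -> vanishes_near f u -> forall x, 0 <= x -> vanishes_near f x.
Proof.
  intros Hf Hu Hv.
  assert (Hloc : forall x, 0 <= x -> exists d, 0 < d /\
     forall y, 0 <= y -> Rabs (y - x) < d -> (vanishes_near f y <-> vanishes_near f x)).
  { intros x Hx. destruct (analytic_dichotomy f x Hx (Hf x Hx)) as [H|H].
    - pose proof H as H'. destruct H' as (d & Hd & H').
      exists d; split; auto. intros y Hy Hyx; split; auto. intros _.
      exists (d - Rabs (y - x)); split; [lra|].
      intros z Hz Hzy; apply H'; auto.
      replace (z - x) with ((z - y) + (y - x)) by ring.
      pose proof (Rabs_triang (z - y) (y - x)); lra.
    - destruct H as (d & Hd & H). exists d; split; auto.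
      intros y Hy Hyx; split; intros (e & He & Hz); exfalso.
      (* The value at [x] itself may be 0, so for [y = x] the contradiction comes from a point
         [x + w] to the right, which stays in the domain. *)
      + destruct (Req_dec y x) as [->|Hne].
        * set (w := Rmin (e / 2) (d / 2)).
          assert (w <= e / 2 /\ w <= d / 2) by (split; [apply Rmin_l|apply Rmin_r]).
          assert (0 < w) by (apply Rmin_pos; lra).
          apply (H (x + w)); [lra| |lra|].
          -- apply Rabs_def1; lra.
          -- apply Hz; [lra|]. apply Rabs_def1; lra.
        * apply (H y); auto. apply Hz; auto. rewrite Rminus_diag, Rabs_R0; auto.
      + set (w := Rmin (e / 2) (d / 2)).
        assert (w <= e / 2 /\ w <= d / 2) by (split; [apply Rmin_l|apply Rmin_r]).
        assert (0 < w) by (apply Rmin_pos; lra).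
        apply (H (x + w)); [lra| |lra|].
        * apply Rabs_def1; lra.
        * apply Hz; [lra|]. apply Rabs_def1; lra. }
  intros x Hx. destruct (Rle_dec u x).
  - apply (locally_constant_segment (vanishes_near f) u x); auto.
    intros y Hy. destruct (Hloc y) as (d & ? & Hd); [lra|]. exists d; split; auto.
    intros; apply Hd; auto; lra.
  - apply (locally_constant_segment (vanishes_near f) x u); [lra| |auto].
    intros y Hy. destruct (Hloc y) as (d & ? & Hd); [lra|]. exists d; split; auto.
    intros; apply Hd; auto; lra.
Qed.

(** * Integer combinations of dilates *)

Fixpoint int_comb (b : nat -> R) (z : nat -> Z) (K : nat) : R :=
  match K with O => 0 | S k => int_comb b z k + IZR (z k) * b k end.

Lemma int_comb_ext b b' z z' K :
  (forall k, (k < K)%nat -> b k = b' k) -> (forall k, (k < K)%nat -> z k = z' k) ->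
  int_comb b z K = int_comb b' z' K.
Proof.
  induction K; intros Hb Hz; simpl; auto.
  rewrite IHK, Hb, Hz by auto; auto.
Qed.

Lemma int_comb_powers_bound z K : exists A, 0 <= A /\ forall j,
  Rabs (int_comb (fun k => INR (S k) ^ j) z K) <= A * INR K ^ j.
Proof.
  induction K as [|K (A & HA & IH)].
  - exists 0; split; [lra|]; intros j; simpl; rewrite Rabs_R0; lra.
  - exists (A + Rabs (IZR (z K))); split; [pose proof (Rabs_pos (IZR (z K))); lra|].
    intros j; cbn [int_comb]. eapply Rle_trans; [apply Rabs_triang|].
    rewrite Rabs_mult, Rmult_plus_distr_r. apply Rplus_le_compat.
    + eapply Rle_trans; [apply IH|]. apply Rmult_le_compat_l; auto.
      apply pow_incr; split; [apply pos_INR|apply le_INR; lia].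
    + rewrite (Rabs_right (INR (S K) ^ j)); [lra|]. apply Rle_ge, pow_le, pos_INR.
Qed.

(* The last nonzero coefficient dominates, since its base is the largest. *)
Lemma int_comb_powers_nonzero z K : (exists k, (k < K)%nat /\ z k <> 0%Z) ->
  exists J, forall j, (J <= j)%nat -> int_comb (fun k => INR (S k) ^ j) z K <> 0.
Proof.
  induction K; intros (k & Hk & Hz); [lia|].
  destruct (Z.eq_dec (z K) 0) as [H0|H0].
  - destruct IHK as [J HJ].
    { exists k; split; auto. assert (k <> K) by congruence. lia. }
    exists J; intros j Hj. cbn [int_comb]. rewrite H0. rewrite Rmult_0_l, Rplus_0_r; auto.
  - destruct (int_comb_powers_bound z K) as (A & HA & HB).
    assert (HzK : 1 <= Rabs (IZR (z K))).
    { rewrite <- abs_IZR. apply IZR_le. lia. }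
    destruct (Nat.eq_dec K 0) as [->|HK].
    { exists 0%nat; intros j _; simpl. rewrite Rplus_0_l, pow1, Rmult_1_r.
      intro E; rewrite E, Rabs_R0 in HzK; lra. }
    assert (HK' : 0 < INR K) by (apply lt_0_INR; lia).
    destruct (INR_unbounded (A * INR K)) as [J HJ].
    exists J; intros j Hj Heq. cbn [int_comb] in Heq.
    specialize (HB j).
    replace (int_comb _ z K) with (- (IZR (z K) * INR (S K) ^ j)) in HB by lra.
    rewrite Rabs_Ropp, Rabs_mult, (Rabs_right (_ ^ _)) in HB
      by (apply Rle_ge, pow_le, pos_INR).
    (* Bernoulli's inequality: the ratio of the [j]-th powers of [K + 1] and [K] exceeds [A] once
       [j > A * K], which explains the choice of [J]. *)
    assert (Hb : 1 + INR j * / INR K <= (1 + / INR K) ^ j).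
    { apply poly. apply Rinv_0_lt_compat; auto. }
    assert (E : INR (S K) ^ j = INR K ^ j * (1 + / INR K) ^ j).
    { rewrite <- Rpow_mult_distr. f_equal. rewrite S_INR. field; lra. }
    rewrite E in HB.
    assert (0 < INR K ^ j) by (apply pow_lt; auto).
    assert (A < INR j * / INR K).
    { apply Rmult_lt_reg_r with (INR K); auto. rewrite Rmult_assoc, Rinv_l by lra.
      apply Rlt_le_trans with (INR J); [lra|]. rewrite Rmult_1_r; apply le_INR; auto. }
    assert (INR K ^ j * (1 + / INR K) ^ j <= Rabs (IZR (z K)) * (INR K ^ j * (1 + / INR K) ^ j)).
    { assert (0 <= INR K ^ j * (1 + / INR K) ^ j).
      { apply Rmult_le_pos; [lra|]. apply pow_le.
        pose proof (Rinv_0_lt_compat _ HK'); lra. }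
      nra. }
    nra.
Qed.

Lemma analytic_int_comb f z K x0 : (forall x, 0 <= x -> analytic_at f x) -> 0 <= x0 ->
  analytic_at (fun u => int_comb (fun k => f (INR (S k) * u)) z K) x0.
Proof.
  intros Hf Hx0; induction K; cbn [int_comb].
  - apply analytic_at_const.
  - apply analytic_at_add; auto. apply analytic_at_scal.
    assert (0 < INR (S K)) by (apply lt_0_INR; lia).
    apply analytic_at_dilate; auto. apply Hf. nra.
Qed.

(** The combination vanishes near 0 as well, so its Taylor coefficients there are 0. From some [J]
    on this forces [c j = 0], so [f] equals a polynomial near 0, and the identity theorem extends
    the equality to the half-line. *)
Lemma relation_forces_polynomial f z K u :
  (forall x, 0 <= x -> analytic_at f x) ->
  (exists k, (k < K)%nat /\ z k <> 0%Z) -> 0 <= u ->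
  vanishes_near (fun v => int_comb (fun k => f (INR (S k) * v)) z K) u ->
  is_polynomial_on_nonneg f.
Proof.
  intros Hf Hz Hu Hv.
  set (g := fun v => int_comb (fun k => f (INR (S k) * v)) z K) in *.
  assert (Hg0 : vanishes_near g 0).
  { eapply identity_theorem with (u := u); eauto; [|lra].
    intros; apply analytic_int_comb; auto. }
  destruct (Hf 0 (Rle_refl 0)) as (r & Hr & c & Hc).
  (* [e j] is the Taylor coefficient of [g] at 0, by the dilation [c j * (S k) ^ j]. *)
  set (e := fun j => c j * int_comb (fun k => INR (S k) ^ j) z K).
  (* For [x < r / K1] every dilate of [x] by a factor up to [K] lies in the disc of convergence at
     0; the extra 1 keeps the divisor positive. *)
  set (K1 := INR K + 1). assert (HK1 : 1 <= K1) by (unfold K1; pose proof (pos_INR K); lra).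
  assert (He : forall x, 0 <= x -> Rabs (x - 0) < r / K1 ->
      Un_cv (fun n => sum_f_R0 (fun i => e i * (x - 0) ^ i) n) (g x)).
  { intros x Hx Hd. rewrite Rminus_0_r in *. rewrite Rabs_right in Hd by lra.
    assert (Hd' : x * K1 < r).
    { apply Rmult_lt_reg_r with (/ K1); [apply Rinv_0_lt_compat; lra|].
      rewrite Rmult_assoc, Rinv_r by lra. unfold Rdiv in Hd; lra. }
    unfold g, e. assert (HKK : (K <= K)%nat) by lia.
    (* Only the number of terms is generalized; the radius [r / K1] stays fixed during the
       induction. *)
    revert HKK; generalize K at 1 3 4; intros L HL.
    induction L; cbn [int_comb].
    - eapply Un_cv_ext; [|apply (Un_cv_const 0)].
      intros n; symmetry; apply sum_eq_R0; intros; ring.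
    - assert (Hc' : Un_cv (fun n => sum_f_R0 (fun i => c i * (INR (S L) * x) ^ i) n) (f (INR (S L) * x))).
      { assert (0 <= INR (S L) <= K1).
        { split; [apply pos_INR|]. unfold K1. rewrite S_INR. apply Rplus_le_compat_r, le_INR; lia. }
        eapply Un_cv_ext; [|apply Hc].
        - intros n; apply sum_eq; intros; now rewrite Rminus_0_r.
        - nra.
        - rewrite Rminus_0_r, Rabs_right; nra. }
      eapply Un_cv_ext; [|apply CV_plus; [apply IHL; lia|apply CV_mult; [apply (Un_cv_const (IZR (z L)))|exact Hc']]].
      intros n; cbv beta. rewrite scal_sum, <- sum_plus. apply sum_eq; intros i _.
      rewrite Rpow_mult_distr; ring. }
  assert (He0 : forall j, e j = 0).
  { apply NNPP; intro H. apply not_all_ex_not in H.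
    destruct (power_series_isolated e g (r / K1) 0) as (d & Hd & Hiso); auto; try lra.
    { apply Rdiv_lt_0_compat; lra. }
    destruct Hg0 as (d' & Hd' & Hg0).
    set (w := Rmin (d / 2) (d' / 2)).
    assert (w <= d / 2 /\ w <= d' / 2) by (split; [apply Rmin_l|apply Rmin_r]).
    assert (0 < w) by (apply Rmin_pos; lra).
    apply (Hiso w); [lra| |lra|]; [|apply Hg0; [lra|]];
      rewrite Rminus_0_r, Rabs_right; lra. }
  destruct (int_comb_powers_nonzero z K Hz) as [J HJ].
  assert (HcJ : forall j, (J <= j)%nat -> c j = 0).
  { intros j Hj. specialize (He0 j). apply Rmult_integral in He0 as [|H]; auto.
    exfalso; eapply HJ; eauto. }
  exists J, c; intros x Hx.
  set (p := fun x => sum_f_R0 (fun i => c i * x ^ i) J).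
  cut (f x + (-1) * p x = 0); [unfold p; lra|].
  destruct (identity_theorem (fun x => f x + -1 * p x) 0) with (x := x) as (d & Hd & H); auto.
  - intros; apply analytic_at_add; auto. apply analytic_at_scal. apply analytic_polynomial.
  - lra.
  - exists r; split; auto. intros y Hy Hyr.
    cut (f y = p y); [lra|].
    eapply UL_sequence; [apply (Hc y); auto|].
    intros eps Heps; exists J; intros n Hn.
    replace (sum_f_R0 _ n) with (p y); [unfold Rdist; rewrite Rminus_diag, Rabs_R0; auto|].
    unfold p; rewrite Rminus_0_r. induction Hn; auto.
    simpl; rewrite <- IHHn, HcJ by lia. ring.
  - apply H; auto. rewrite Rminus_diag, Rabs_R0; auto.
Qed.

(** * Kronecker's theorem *)

(** A strong form of mean zero along the integers. It is stable under linear combinations, so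
    trigonometric polynomials can be treated one cosine at a time. *)
Definition bounded_sums (g : nat -> R) : Prop :=
  exists C, forall N, Rabs (sum_f_R0 g N) <= C.

Lemma bounded_sums_ext g h : (forall n, g n = h n) -> bounded_sums g -> bounded_sums h.
Proof.
  intros H [C HC]; exists C; intros N. rewrite (sum_eq h g); auto.
Qed.

Lemma bounded_sums_add g h : bounded_sums g -> bounded_sums h ->
  bounded_sums (fun n => g n + h n).
Proof.
  intros [C HC] [D HD]; exists (C + D); intros N. rewrite sum_plus.
  eapply Rle_trans; [apply Rabs_triang|]. apply Rplus_le_compat; auto.
Qed.

Lemma bounded_sums_scal a g : bounded_sums g -> bounded_sums (fun n => a * g n).
Proof.
  intros [C HC]; exists (Rabs a * C); intros N.
  rewrite (sum_eq _ (fun n => g n * a)) by (intros; ring).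
  rewrite <- scal_sum, Rabs_mult. apply Rmult_le_compat_l; auto. apply Rabs_pos.
Qed.

Lemma sin_PI_mul_nonzero b : (forall w : Z, b <> IZR w) -> sin (PI * b) <> 0.
Proof.
  intros H Hs. apply sin_eq_0_0 in Hs as [k Hk]. apply (H k).
  pose proof PI_RGT_0. apply Rmult_eq_reg_l with PI; lra.
Qed.

(* Telescoping after multiplication by [2 * sin (PI * b)]. *)
Lemma bounded_sums_cos b phi : (forall w : Z, b <> IZR w) ->
  bounded_sums (fun s => cos (2 * PI * (INR s * b) + phi)).
Proof.
  intros Hb. pose proof (sin_PI_mul_nonzero b Hb) as Hs.
  assert (H : forall N, 2 * sin (PI * b) * sum_f_R0 (fun s => cos (2 * PI * (INR s * b) + phi)) N
     = sin (2 * PI * (INR N * b) + phi + PI * b) - sin (phi - PI * b)).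
  { induction N.
    - simpl. replace (2 * PI * (0 * b) + phi) with phi by ring.
      rewrite sin_plus, sin_minus; ring.
    - cbn [sum_f_R0]. rewrite Rmult_plus_distr_l, IHN, S_INR.
      replace (2 * PI * (INR N * b) + phi + PI * b) with
       (2 * PI * ((INR N + 1) * b) + phi - PI * b) by ring.
      rewrite sin_plus, sin_minus; ring. }
  exists (2 / Rabs (2 * sin (PI * b))). intros N.
  assert (0 < Rabs (2 * sin (PI * b))) by (apply Rabs_pos_lt; lra).
  apply Rmult_le_reg_l with (Rabs (2 * sin (PI * b))); auto.
  rewrite <- Rabs_mult, H. replace (_ * (2 / _)) with 2 by (field; lra).
  pose proof (SIN_bound (2 * PI * (INR N * b) + phi + PI * b)).
  pose proof (SIN_bound (phi - PI * b)).
  apply Rabs_le; lra.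
Qed.

(** * Dirichlet and Fejer kernels *)

Fixpoint dirichlet (p : nat) (y : R) : R :=
  match p with O => 1 | S q => dirichlet q y + 2 * cos (INR (S q) * y) end.

(* [p] times the usual Fejer kernel of order [p]; its mean is [p]. *)
Fixpoint fejer (p : nat) (y : R) : R :=
  match p with O => 0 | S q => fejer q y + dirichlet q y end.

Lemma dirichlet_identity p y :
  (1 - cos y) * dirichlet p y = cos (INR p * y) - cos (INR (S p) * y).
Proof.
  induction p.
  - simpl. rewrite Rmult_0_l, cos_0, Rmult_1_l. ring.
  - cbn [dirichlet]. rewrite Rmult_plus_distr_l, IHp, (S_INR (S p)).
    replace (INR p * y) with (INR (S p) * y - y) by (rewrite S_INR; ring).
    replace ((INR (S p) + 1) * y) with (INR (S p) * y + y) by ring.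
    rewrite cos_plus, cos_minus; ring.
Qed.

Lemma fejer_identity p y : (1 - cos y) * fejer p y = 1 - cos (INR p * y).
Proof.
  induction p.
  - simpl. rewrite Rmult_0_l, cos_0; ring.
  - cbn [fejer]. rewrite Rmult_plus_distr_l, IHp, dirichlet_identity; ring.
Qed.

(** If [cos y <> 1], divide [fejer_identity] by the positive number [1 - cos y]. If [cos y = 1],
    every cosine in the kernel equals 1. *)
Lemma fejer_nonneg p y : 0 <= fejer p y.
Proof.
  destruct (COS_bound y) as [_ H].
  destruct (Req_dec (cos y) 1) as [E|E].
  - assert (Hs : sin y = 0).
    { pose proof (sin2_cos2 y). unfold Rsqr in *. rewrite E in *. nra. }
    assert (Hm : forall m, cos (INR m * y) = 1).
    { induction m; [simpl; rewrite Rmult_0_l; apply cos_0|].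
      rewrite S_INR, Rmult_plus_distr_r, Rmult_1_l, cos_plus, IHm, E, Hs; ring. }
    assert (Hd : forall q, 0 <= dirichlet q y).
    { induction q; cbn [dirichlet]; [lra|]. rewrite Hm; lra. }
    induction p; cbn [fejer]; [lra|]. specialize (Hd p); lra.
  - pose proof (fejer_identity p y). pose proof (COS_bound (INR p * y)).
    apply Rnot_lt_le; intro. nra.
Qed.

Section Kronecker.
Variable b theta : nat -> R.

Let phase (k s : nat) : R := 2 * PI * (INR s * b k - theta k).

(** A nonnegative trigonometric polynomial on the [K]-torus, evaluated along the orbit of [b] and
    favouring those [s] for which each [s * b k] is near [theta k] modulo 1. Its constant term is
    [weight]. *)
Fixpoint kernel_prod (P : nat -> nat) (K s : nat) : R :=
  match K with O => 1 | S k => kernel_prod P k s * fejer (P k) (phase k s) end.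

Fixpoint weight (P : nat -> nat) (K : nat) : R :=
  match K with O => 1 | S k => weight P k * INR (P k) end.

(** Expanding the kernels shifts the frequency [beta] by integer multiples of the [b k]. It never
    becomes an integer, so each resulting cosine has bounded sums. The shifts by [theta] are
    absorbed in the arbitrary [phi]. *)
Lemma kernel_prod_osc P K : forall beta,
  (forall z w, beta <> IZR w + int_comb b z K) -> forall phi,
  bounded_sums (fun s => cos (2 * PI * (INR s * beta) + phi) * kernel_prod P K s).
Proof.
  induction K; intros beta Hb phi; cbn [kernel_prod].
  - eapply bounded_sums_ext; [intros; symmetry; apply Rmult_1_r|].
    apply bounded_sums_cos. intros w E. apply (Hb (fun _ => 0%Z) w). simpl; lra.
  - (* product-to-sum formula; the shifted frequencies stay outside the smaller span *)
    assert (Hcos : forall m, bounded_sums (fun s =>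
       cos (2 * PI * (INR s * beta) + phi) * cos (INR m * phase K s) * kernel_prod P K s)).
    { intros m.
      assert (Hz : forall e : Z, forall z w, beta + IZR e * b K <> IZR w + int_comb b z K).
      { intros e z w E.
        apply (Hb (fun k => if Nat.eqb k K then (- e)%Z else z k) w).
        cbn [int_comb]. rewrite Nat.eqb_refl.
        rewrite (int_comb_ext b b _ z); [rewrite opp_IZR; lra|auto|].
        intros k Hk. replace (Nat.eqb k K) with false; auto.
        symmetry; apply Nat.eqb_neq; lia. }
      eapply bounded_sums_ext; [|apply bounded_sums_scal with (a := / 2); apply bounded_sums_add;
        [apply (IHK _ (Hz (Z.of_nat m)) (phi - 2 * PI * INR m * theta K))
        |apply (IHK _ (Hz (- Z.of_nat m)%Z) (phi + 2 * PI * INR m * theta K))]].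
      intros s; cbv beta. rewrite opp_IZR, <- INR_IZR_INZ. unfold phase.
      set (A := 2 * PI * (INR s * beta) + phi).
      set (B := INR m * (2 * PI * (INR s * b K - theta K))).
      replace (2 * PI * (INR s * (beta + INR m * b K)) + (phi - 2 * PI * INR m * theta K))
        with (A + B) by (unfold A, B; ring).
      replace (2 * PI * (INR s * (beta + - INR m * b K)) + (phi + 2 * PI * INR m * theta K))
        with (A - B) by (unfold A, B; ring).
      rewrite cos_plus, cos_minus. field. }
    assert (Hdir : forall p, bounded_sums (fun s =>
       cos (2 * PI * (INR s * beta) + phi) * dirichlet p (phase K s) * kernel_prod P K s)).
    { induction p; cbn [dirichlet].
      - eapply bounded_sums_ext; [|apply (Hcos 0%nat)].
        intros s; cbv beta. simpl INR; rewrite Rmult_0_l, cos_0; ring.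
      - eapply bounded_sums_ext; [|apply bounded_sums_add;
          [apply IHp|apply bounded_sums_scal with (a := 2); apply (Hcos (S p))]].
        intros s; cbv beta; ring. }
    cut (forall p, bounded_sums (fun s =>
       cos (2 * PI * (INR s * beta) + phi) * fejer p (phase K s) * kernel_prod P K s)).
    { intros H; eapply bounded_sums_ext; [|apply (H (P K))]; intros; cbv beta; ring. }
    induction p; cbn [fejer].
    + exists 0; intros N. rewrite sum_eq_R0; [rewrite Rabs_R0; lra|intros; ring].
    + eapply bounded_sums_ext; [|apply bounded_sums_add; [apply IHp|apply (Hdir p)]].
      intros s; cbv beta; ring.
Qed.

(** Linear independence of 1 and the first [K] values of [b] over the rationals, with denominators
    cleared. *)
Definition independent_with_one (K : nat) : Prop :=
  forall z w, int_comb b z K = IZR w -> forall k, (k < K)%nat -> z k = 0%Z.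

Lemma independent_with_one_pred K : independent_with_one (S K) -> independent_with_one K.
Proof.
  intros H z w E k Hk.
  pose proof (H (fun i => if Nat.eqb i K then 0%Z else z i) w) as H'.
  cbn [int_comb] in H'. rewrite Nat.eqb_refl in H'.
  assert (Hne : forall i, (i < K)%nat -> Nat.eqb i K = false)
    by (intros; apply Nat.eqb_neq; lia).
  specialize (H' ltac:(rewrite (int_comb_ext b b _ z); auto;
    [lra|intros i Hi; now rewrite Hne]) k ltac:(lia)).
  cbv beta in H'. now rewrite Hne in H'.
Qed.

(** Only the constant term survives averaging: the other terms of the last kernel have frequency a
    positive multiple of [b K], which independence keeps outside the span of 1 and the earlier
    [b k]. *)
Lemma kernel_prod_mean P K : independent_with_one K ->
  bounded_sums (fun s => kernel_prod P K s + - weight P K).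
Proof.
  induction K; intros Hind; cbn [kernel_prod weight].
  - exists 0; intros N. rewrite sum_eq_R0; [rewrite Rabs_R0; lra|intros; ring].
  - specialize (IHK (independent_with_one_pred K Hind)).
    assert (Hcos : forall m, bounded_sums (fun s => cos (INR (S m) * phase K s) * kernel_prod P K s)).
    { intros m. eapply bounded_sums_ext; [|apply (kernel_prod_osc P K (INR (S m) * b K)) with
        (phi := - (2 * PI * INR (S m) * theta K))].
      - intros s; cbv beta. f_equal. f_equal. unfold phase. ring.
      - intros z w E.
        (* If [S m * b K] lay in the span, this would be a relation whose coefficient at [K] is the
           nonzero [S m]. *)
        pose proof (Hind (fun i => if Nat.eqb i K then Z.of_nat (S m) else (- z i)%Z) w) as H'.
        cbn [int_comb] in H'. rewrite Nat.eqb_refl in H'.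
        assert (Hopp : forall L, (L <= K)%nat -> int_comb b (fun i => if Nat.eqb i K then Z.of_nat (S m) else (- z i)%Z) L
             = - int_comb b z L).
        { induction L; intros HL; cbn [int_comb]; [ring|]. rewrite IHL by lia.
          replace (Nat.eqb L K) with false by (symmetry; apply Nat.eqb_neq; lia).
          rewrite opp_IZR; ring. }
        rewrite Hopp, <- INR_IZR_INZ in H' by lia.
        specialize (H' ltac:(lra) K ltac:(lia)). cbv beta in H'.
        rewrite Nat.eqb_refl in H'. lia. }
    assert (Hdir : forall p, bounded_sums (fun s => dirichlet p (phase K s) * kernel_prod P K s + - weight P K)).
    { induction p; cbn [dirichlet].
      - eapply bounded_sums_ext; [|apply IHK]. intros; cbv beta; ring.
      - eapply bounded_sums_ext; [|apply bounded_sums_add;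
          [apply IHp|apply bounded_sums_scal with (a := 2); apply (Hcos p)]].
        intros s; cbv beta; ring. }
    generalize (P K); induction n; cbn [fejer].
    + exists 0; intros N. rewrite sum_eq_R0; [rewrite Rabs_R0; lra|intros; simpl; ring].
    + eapply bounded_sums_ext; [|apply bounded_sums_add; [apply IHn|apply (Hdir n)]].
      intros s; cbv beta. rewrite S_INR; ring.
Qed.

Lemma kernel_prod_nonneg P K s : 0 <= kernel_prod P K s.
Proof.
  induction K; cbn [kernel_prod]; [lra|]. apply Rmult_le_pos; auto. apply fejer_nonneg.
Qed.

Lemma fejer_1 y : fejer 1 y = 1.
Proof. simpl; ring. Qed.

(** The kernel of order 1 is constantly 1, so order 1 at [j] leaves that coordinate free. *)
Definition drop_kernel (p j k : nat) : nat := if Nat.eqb k j then 1%nat else p.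

Lemma drop_kernel_same p j : drop_kernel p j j = 1%nat.
Proof. unfold drop_kernel; now rewrite Nat.eqb_refl. Qed.

Lemma drop_kernel_other p j k : k <> j -> drop_kernel p j k = p.
Proof. intros H; unfold drop_kernel; now apply Nat.eqb_neq in H as ->. Qed.

(** The factor [1 - cos] cancels the [j]-th kernel by [fejer_identity], leaving
    [1 - cos (p * phase)], which is at most 2. *)
Lemma kernel_prod_drop p K j s : (j < K)%nat ->
  (1 - cos (phase j s)) * kernel_prod (fun _ => p) K s <= 2 * kernel_prod (drop_kernel p j) K s.
Proof.
  intros Hj.
  assert (E : kernel_prod (fun _ => p) K s = kernel_prod (drop_kernel p j) K s * fejer p (phase j s)).
  { assert (Hsame : forall L, (L <= j)%nat -> kernel_prod (fun _ => p) L s = kernel_prod (drop_kernel p j) L s).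
    { induction L; intros HL; cbn [kernel_prod]; auto. rewrite IHL by lia.
      rewrite drop_kernel_other by lia; auto. }
    induction K; [lia|]. cbn [kernel_prod].
    destruct (Nat.eq_dec K j) as [->|E].
    - rewrite Hsame, drop_kernel_same, fejer_1 by lia. ring.
    - rewrite IHK, drop_kernel_other by lia. ring. }
  rewrite E. replace (_ * (_ * _)) with
    (((1 - cos (phase j s)) * fejer p (phase j s)) * kernel_prod (drop_kernel p j) K s) by ring.
  rewrite fejer_identity. apply Rmult_le_compat_r; [apply kernel_prod_nonneg|].
  pose proof (COS_bound (INR p * phase j s)); lra.
Qed.

Lemma weight_const p K : weight (fun _ => p) K = INR p ^ K.
Proof. induction K; cbn [weight]; [reflexivity|]. rewrite IHK; simpl; ring. Qed.

Lemma weight_drop p K j : (j < K)%nat -> weight (drop_kernel p j) K * INR p = INR p ^ K.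
Proof.
  intros Hj.
  assert (Hsame : forall L, (L <= j)%nat -> weight (drop_kernel p j) L = INR p ^ L).
  { induction L; intros HL; cbn [weight]; auto. rewrite IHL by lia.
    rewrite drop_kernel_other by lia; simpl; ring. }
  induction K; [lia|]. cbn [weight].
  destruct (Nat.eq_dec K j) as [->|E].
  - rewrite Hsame, drop_kernel_same by lia. simpl; ring.
  - rewrite (drop_kernel_other p j K) by lia.
    replace (_ * _ * _) with (weight (drop_kernel p j) K * INR p * INR p) by ring.
    rewrite IHK by lia. simpl; ring.
Qed.

Lemma bounded_sums_upper g w : bounded_sums (fun s => g s + - w) ->
  exists C, forall N, Rabs (sum_f_R0 g N - INR (S N) * w) <= C.
Proof.
  intros [C HC]; exists C; intros N. specialize (HC N).
  rewrite sum_plus, sum_cte in HC. replace (_ - _) with (sum_f_R0 g N + - w * INR (S N)) by ring.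
  auto.
Qed.

Fixpoint rsum (g : nat -> R) (K : nat) : R :=
  match K with O => 0 | S k => rsum g k + g k end.

Lemma rsum_nonneg_ge g K j : (forall k, 0 <= g k) -> (j < K)%nat -> g j <= rsum g K.
Proof.
  intros Hg Hj.
  assert (Hp : forall L, 0 <= rsum g L).
  { induction L; cbn [rsum]; [lra|]. specialize (Hg L); lra. }
  induction K; [lia|]. cbn [rsum]. destruct (Nat.eq_dec j K) as [->|].
  - specialize (Hp K); lra.
  - specialize (IHK ltac:(lia)); specialize (Hg K); lra.
Qed.

(** Suppose that every [s] misses its target in some coordinate [j]. Then [kappa] times the full
    product is at most twice the sum over [j] of the products without the [j]-th kernel. Taking
    means gives [kappa * p ^ K <= 2 * K * p ^ (K - 1)], which fails for [p > 2 * K / kappa]. *)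
Lemma kronecker_cos K kappa : independent_with_one K -> 0 < kappa ->
  exists s, forall k, (k < K)%nat -> 1 - cos (phase k s) < kappa.
Proof.
  intros Hind Hk. apply NNPP; intro Hno.
  assert (Hbad : forall s, exists j, (j < K)%nat /\ kappa <= 1 - cos (phase j s)).
  { intros s. apply NNPP; intro H. apply Hno; exists s; intros k Hlt.
    apply Rnot_le_lt; intro; apply H; eauto. }
  destruct (INR_unbounded (2 * INR K / kappa)) as [p Hp].
  assert (Hp' : 2 * INR K < kappa * INR p).
  { apply Rmult_lt_compat_l with (r := kappa) in Hp; auto.
    replace (kappa * (2 * INR K / kappa)) with (2 * INR K) in Hp by (field; lra). auto. }
  assert (Hp0 : 0 < INR p) by (pose proof (pos_INR K); nra).
  set (Q := kernel_prod (fun _ => p) K).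
  set (Qd := fun j => kernel_prod (drop_kernel p j) K).
  set (V := INR p ^ K). assert (HV : 0 < V) by (apply pow_lt; auto).
  assert (Hpt : forall s, kappa * Q s <= 2 * rsum (fun j => Qd j s) K).
  { intros s. destruct (Hbad s) as (j & Hj & Hjk).
    apply Rle_trans with ((1 - cos (phase j s)) * Q s).
    - apply Rmult_le_compat_r; auto. apply kernel_prod_nonneg.
    - eapply Rle_trans; [apply kernel_prod_drop; auto|].
      apply Rmult_le_compat_l; [lra|]. apply (rsum_nonneg_ge (fun j => Qd j s)); auto.
      intros; apply kernel_prod_nonneg. }
  assert (Hup : exists C, forall N, sum_f_R0 (fun s => rsum (fun j => Qd j s) K) N
      <= INR (S N) * (INR K * (V / INR p)) + C).
  { cut (forall L, (L <= K)%nat -> exists C, forall N, sum_f_R0 (fun s => rsum (fun j => Qd j s) L) N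
      <= INR (S N) * (INR L * (V / INR p)) + C); [intros H; apply (H K); lia|].
    induction L; intros HL.
    - exists 0; intros N; cbn [rsum]. rewrite sum_eq_R0 by auto. simpl (INR 0); lra.
    - destruct (IHL ltac:(lia)) as [C HC].
      destruct (bounded_sums_upper _ _ (kernel_prod_mean (drop_kernel p L) K Hind)) as [D HD].
      exists (C + D); intros N. cbn [rsum]. rewrite sum_plus.
      specialize (HC N); specialize (HD N).
      replace (weight (drop_kernel p L) K) with (V / INR p) in HD.
      2:{ unfold V; rewrite <- (weight_drop p K L) by lia. field; lra. }
      assert (HD' := Rle_trans _ _ _ (Rle_abs _) HD).
      change (kernel_prod (drop_kernel p L) K) with (Qd L) in HD'.
      change (sum_f_R0 (fun l => Qd L l) N) with (sum_f_R0 (Qd L) N).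
      rewrite (S_INR L). lra. }
  destruct Hup as [C HC].
  destruct (bounded_sums_upper _ _ (kernel_prod_mean (fun _ => p) K Hind)) as [D HD].
  rewrite weight_const in HD. fold Q V in HD.
  (* The means are compared up to bounded errors: the left side grows linearly in [N], with positive
     slope by the choice of [p], while the right side is constant. *)
  assert (Hall : forall N, INR (S N) * (V * (kappa * INR p - 2 * INR K)) <= INR p * (kappa * D + 2 * C)).
  { intros N. specialize (HC N); specialize (HD N).
    assert (H1 : kappa * sum_f_R0 Q N <= 2 * sum_f_R0 (fun s => rsum (fun j => Qd j s) K) N).
    { rewrite !scal_sum. apply sum_Rle; intros s _. specialize (Hpt s). lra. }
    rewrite Rabs_minus_sym in HD. assert (HD' := Rle_trans _ _ _ (Rle_abs _) HD).
    assert (H2 : kappa * (INR (S N) * V - D) <= 2 * (INR (S N) * (INR K * (V / INR p)) + C)).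
    { apply Rle_trans with (kappa * sum_f_R0 Q N); [apply Rmult_le_compat_l; lra|lra]. }
    apply Rmult_le_compat_l with (r := INR p) in H2; [|lra].
    replace (INR p * (2 * (INR (S N) * (INR K * (V / INR p)) + C))) with
      (2 * (INR (S N) * (INR K * V)) + 2 * INR p * C) in H2 by (field; lra).
    lra. }
  assert (Hpos : 0 < V * (kappa * INR p - 2 * INR K)) by (apply Rmult_lt_0_compat; lra).
  destruct (INR_unbounded (INR p * (kappa * D + 2 * C) / (V * (kappa * INR p - 2 * INR K)))) as [N HN].
  specialize (Hall N). rewrite S_INR in Hall.
  apply Rmult_lt_compat_r with (r := V * (kappa * INR p - 2 * INR K)) in HN; auto.
  replace (INR p * (kappa * D + 2 * C) / (V * (kappa * INR p - 2 * INR K)) * (V * (kappa * INR p - 2 * INR K)))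
    with (INR p * (kappa * D + 2 * C)) in HN by (field; split; lra).
  lra.
Qed.

End Kronecker.

Lemma cos_away_from_integers y d : 0 < d <= / 2 -> 1 - cos (2 * PI * y) < 1 - cos (2 * PI * d) ->
  exists w : Z, Rabs (y - IZR w) < d.
Proof.
  intros Hd Hc. pose proof PI_RGT_0.
  (* This is a nearest integer to [y]. The distance is at most 1/2, so the angle falls in the
     interval from 0 to [PI], where cosine decreases. *)
  set (w := up (y - / 2)). destruct (archimed (y - / 2)) as [H1 H2].
  fold w in H1, H2.
  assert (E : cos (2 * PI * y) = cos (2 * PI * Rabs (y - IZR w))).
  { transitivity (cos (2 * PI * (y - IZR w))).
    - replace (2 * PI * y) with (2 * PI * (y - IZR w) + 2 * IZR w * PI) by ring.
      destruct (Z_le_dec 0 w).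
      + replace w with (Z.of_nat (Z.to_nat w)) by lia. rewrite <- INR_IZR_INZ.
        apply cos_period.
      + set (x := 2 * PI * (y - IZR w)).
        replace (IZR w) with (- INR (Z.to_nat (- w))).
        2:{ rewrite INR_IZR_INZ, Z2Nat.id, opp_IZR by lia. ring. }
        rewrite <- (cos_period (x + _) (Z.to_nat (-w))). f_equal. ring.
    - unfold Rabs; destruct Rcase_abs; auto.
      rewrite <- cos_neg; f_equal; ring. }
  exists w. apply Rnot_le_lt; intro Hle.
  assert (Rabs (y - IZR w) <= / 2) by (apply Rabs_le; lra).
  assert (cos (2 * PI * Rabs (y - IZR w)) <= cos (2 * PI * d)).
  { apply cos_decr_1; try nra. }
  lra.
Qed.

Theorem kronecker (b theta : nat -> R) K d :
  independent_with_one b K -> 0 < d <= / 2 ->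
  exists s : nat, forall k, (k < K)%nat -> exists w : Z, Rabs (INR s * b k - theta k - IZR w) < d.
Proof.
  intros Hind Hd. pose proof PI_RGT_0.
  destruct (kronecker_cos b theta K (1 - cos (2 * PI * d)) Hind) as [s Hs].
  - assert (cos (2 * PI * d) < cos 0) by (apply cos_decreasing_1; nra).
    rewrite cos_0 in *; lra.
  - exists s; intros k Hk. apply cos_away_from_integers; auto.
Qed.

(** * Probability spaces and rotations *)

Lemma pred_ext {X : Type} (A B : X -> Prop) : (forall x, A x <-> B x) -> A = B.
Proof.
  intros H; apply functional_extensionality; intros x; apply propositional_extensionality; auto.
Qed.

Section SigmaAlgebra.
Context {X : Type} (B : (X -> Prop) -> Prop) (HB : is_sigma_algebra B).

Lemma sigma_full : B (fun _ => True).
Proof. apply HB. Qed.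

Lemma sigma_compl A : B A -> B (fun x => ~ A x).
Proof. apply HB. Qed.

Lemma sigma_exists (A : nat -> X -> Prop) : (forall n, B (A n)) -> B (fun x => exists n, A n x).
Proof. apply HB. Qed.

Lemma sigma_empty : B (fun _ => False).
Proof.
  replace (fun _ : X => False) with (fun x : X => ~ True) by (apply pred_ext; tauto).
  apply sigma_compl, sigma_full.
Qed.

Lemma sigma_or A C : B A -> B C -> B (fun x => A x \/ C x).
Proof.
  intros HA HC.
  replace (fun x => A x \/ C x) with (fun x => exists n, (match n with O => A | _ => C end) x).
  - apply sigma_exists; intros [|n]; auto.
  - apply pred_ext; intros x; split; [intros [[|n] H]; auto|].
    intros [H|H]; [exists 0%nat|exists 1%nat]; auto.
Qed.

Lemma sigma_and A C : B A -> B C -> B (fun x => A x /\ C x).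
Proof.
  intros HA HC.
  replace (fun x => A x /\ C x) with (fun x => ~ (~ A x \/ ~ C x))
    by (apply pred_ext; intros; tauto).
  apply sigma_compl, sigma_or; apply sigma_compl; auto.
Qed.

Lemma sigma_forall (A : nat -> X -> Prop) : (forall n, B (A n)) -> B (fun x => forall n, A n x).
Proof.
  intros H. replace (fun x => forall n, A n x) with (fun x => ~ exists n, ~ A n x).
  - apply sigma_compl, sigma_exists. intros n; apply sigma_compl; auto.
  - apply pred_ext; intros x; split.
    + intros H' n. apply NNPP; intro; apply H'; eauto.
    + intros H' [n Hn]; auto.
Qed.

Lemma sigma_exists_Z (A : Z -> X -> Prop) : (forall w, B (A w)) -> B (fun x => exists w, A w x).
Proof.
  intros H.
  replace (fun x => exists w, A w x) with
    (fun x => (exists n, A (Z.of_nat n) x) \/ (exists n, A (- Z.of_nat n)%Z x)).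
  - apply sigma_or; apply sigma_exists; auto.
  - apply pred_ext; intros x; split; [intros [[n Hn]|[n Hn]]; eauto|].
    intros [w Hw]. destruct (Z_le_dec 0 w).
    + left; exists (Z.to_nat w); rewrite Z2Nat.id; auto.
    + right; exists (Z.to_nat (- w)); rewrite Z2Nat.id, Z.opp_involutive by lia; auto.
Qed.

Lemma sigma_const (P : Prop) : B (fun _ => P).
Proof.
  destruct (classic P).
  - replace (fun _ : X => P) with (fun _ : X => True) by (apply pred_ext; tauto). apply sigma_full.
  - replace (fun _ : X => P) with (fun _ : X => False) by (apply pred_ext; tauto). apply sigma_empty.
Qed.

End SigmaAlgebra.

Lemma generated_sigma_algebra {X : Type} (G : (X -> Prop) -> Prop) :
  is_sigma_algebra (generated_sigma G).
Proof.
  split; [|split].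
  - intros B HB _; apply HB.
  - intros A HA B HB HG; apply HB; apply HA; auto.
  - intros A HA B HB HG; apply HB; intros n; apply HA; auto.
Qed.

Lemma generated_sigma_gen {X : Type} (G : (X -> Prop) -> Prop) S : G S -> generated_sigma G S.
Proof. intros HS B _ HG; auto. Qed.

(** The sets whose preimage lies in [B] form a sigma-algebra containing [G]. *)
Lemma generated_sigma_preimage {X Y : Type} (G : (X -> Prop) -> Prop) (B : (Y -> Prop) -> Prop)
  (phi : Y -> X) : is_sigma_algebra B -> (forall S, G S -> B (fun y => S (phi y))) ->
  forall A, generated_sigma G A -> B (fun y => A (phi y)).
Proof.
  intros HB HG A HA. apply (HA (fun A => B (fun y => A (phi y)))); auto.
  split; [|split].
  - apply HB.
  - intros C HC; apply HB in HC; auto.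
  - intros C HC. apply (sigma_exists B HB (fun n y => C n (phi y))); auto.
Qed.

Definition indic {X : Type} (A : X -> Prop) (x : X) : R :=
  if excluded_middle_informative (A x) then 1 else 0.

Lemma indic_1 {X : Type} (A : X -> Prop) x : A x -> indic A x = 1.
Proof. unfold indic; destruct excluded_middle_informative; tauto. Qed.

Lemma indic_0 {X : Type} (A : X -> Prop) x : ~ A x -> indic A x = 0.
Proof. unfold indic; destruct excluded_middle_informative; tauto. Qed.

Lemma indic_bounds {X : Type} (A : X -> Prop) x : 0 <= indic A x <= 1.
Proof. unfold indic; destruct excluded_middle_informative; lra. Qed.

Section Probability.
Context {X : Type} (B : (X -> Prop) -> Prop) (mu : (X -> Prop) -> R).
Hypothesis Hp : is_probability_space B mu.

Let HB : is_sigma_algebra B := proj1 Hp.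

Lemma prob_nonneg A : B A -> 0 <= mu A.
Proof. apply Hp. Qed.

Lemma prob_full : mu (fun _ => True) = 1.
Proof. apply Hp. Qed.

Lemma prob_sigma_additive (A : nat -> X -> Prop) : (forall n, B (A n)) ->
  (forall n m x, n <> m -> A n x -> A m x -> False) ->
  Un_cv (fun N => sum_f_R0 (fun n => mu (A n)) N) (mu (fun x => exists n, A n x)).
Proof. apply Hp. Qed.

(** Countably many copies of the empty set are disjoint, and a convergent series of equal terms has
    zero terms. *)
Lemma prob_empty : mu (fun _ => False) = 0.
Proof.
  pose proof (prob_sigma_additive (fun _ _ => False) (fun _ => sigma_empty B HB)
    (fun _ _ _ _ H _ => H)) as H.
  set (c := mu (fun _ => False)) in *.
  pose proof (CV_minus _ _ _ _ (CV_shift' _ 1 _ H) H) as H'.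
  rewrite Rminus_diag in H'. eapply UL_sequence; [|exact H'].
  eapply Un_cv_ext; [|apply (Un_cv_const c)]. intros n; cbv beta.
  rewrite Nat.add_1_r; cbn [sum_f_R0]. unfold c; ring.
Qed.

Lemma prob_add A C : B A -> B C -> (forall x, A x -> C x -> False) ->
  mu (fun x => A x \/ C x) = mu A + mu C.
Proof.
  intros HA HC Hd.
  set (D := fun n => match n with O => A | 1%nat => C | _ => fun _ => False end).
  assert (H : Un_cv (fun N => sum_f_R0 (fun n => mu (D n)) N) (mu (fun x => exists n, D n x))).
  { apply prob_sigma_additive.
    - intros [|[|n]]; simpl; auto. apply sigma_empty; auto.
    - intros [|[|n]] [|[|m]] x; simpl; try tauto; eauto. }
  replace (fun x => A x \/ C x) with (fun x => exists n, D n x).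
  2:{ apply pred_ext; intros x; split.
      - intros [[|[|n]] Hn]; simpl in Hn; tauto.
      - intros [?|?]; [exists 0%nat|exists 1%nat]; auto. }
  eapply UL_sequence; [exact H|].
  apply CV_shift with (k := 1%nat). eapply Un_cv_ext; [|apply Un_cv_const].
  intros n; cbv beta; rewrite Nat.add_1_r. induction n; simpl in *; auto.
  rewrite <- IHn, prob_empty; ring.
Qed.

Lemma prob_split S E : B S -> B E ->
  mu S = mu (fun x => S x /\ E x) + mu (fun x => S x /\ ~ E x).
Proof.
  intros HS HE. rewrite <- prob_add.
  - f_equal; apply pred_ext; intros x; tauto.
  - apply sigma_and; auto.
  - apply sigma_and; auto; apply sigma_compl; auto.
  - tauto.
Qed.

Lemma prob_mono A C : B A -> B C -> (forall x, A x -> C x) -> mu A <= mu C.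
Proof.
  intros HA HC Hs. rewrite (prob_split C A) by auto.
  replace (fun x => C x /\ A x) with A by (apply pred_ext; firstorder).
  pose proof (prob_nonneg (fun x => C x /\ ~ A x)
    (sigma_and B HB _ _ HC (sigma_compl B HB _ HA))). lra.
Qed.

Lemma prob_le_1 A : B A -> mu A <= 1.
Proof.
  intros HA. rewrite <- prob_full. apply prob_mono; auto. apply sigma_full; auto.
Qed.

Lemma prob_subadd A C : B A -> B C -> mu (fun x => A x \/ C x) <= mu A + mu C.
Proof.
  intros HA HC. rewrite (prob_split (fun x => A x \/ C x) A) by (auto; apply sigma_or; auto).
  replace (fun x => (A x \/ C x) /\ A x) with A by (apply pred_ext; intros; tauto).
  apply Rplus_le_compat_l, prob_mono; auto; [|tauto].
  apply sigma_and; auto; [apply sigma_or|apply sigma_compl]; auto.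
Qed.

Lemma prob_continuity (A : nat -> X -> Prop) : (forall n, B (A n)) ->
  (forall n x, A n x -> A (S n) x) -> Un_cv (fun n => mu (A n)) (mu (fun x => exists n, A n x)).
Proof.
  intros HA Hinc.
  assert (Hmono : forall n m x, (n <= m)%nat -> A n x -> A m x).
  { intros n m x Hnm; induction Hnm; auto. }
  set (D := fun n x => A n x /\ match n with O => True | S m => ~ A m x end).
  assert (HD : forall n, B (D n)).
  { intros n; apply sigma_and; auto. destruct n; [apply sigma_full|apply sigma_compl]; auto. }
  assert (Hdis : forall n m x, (n < m)%nat -> D n x -> D m x -> False).
  { intros n [|m] x Hlt [H1 _] [_ H2]; [lia|]. apply H2, (Hmono n); auto. lia. }
  assert (H : Un_cv (fun N => sum_f_R0 (fun n => mu (D n)) N) (mu (fun x => exists n, D n x))).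
  { apply prob_sigma_additive; auto. intros n m x Hne.
    destruct (Nat.lt_ge_cases n m); [eauto|]. intros; apply (Hdis m n x); auto. lia. }
  replace (fun x => exists n, A n x) with (fun x => exists n, D n x).
  2:{ apply pred_ext; intros x; split; [intros [n [Hn _]]; eauto|].
      intros [n Hn]. induction n as [n IH] using (well_founded_induction lt_wf).
      destruct n; [exists 0%nat; split; auto|].
      destruct (classic (A n x)) as [H'|H']; [apply (IH n); auto|].
      exists (S n); split; auto. }
  eapply Un_cv_ext; [|exact H]. intros n.
  induction n; cbn [sum_f_R0].
  - f_equal. unfold D; apply pred_ext; intros; tauto.
  - rewrite IHn, Rplus_comm. rewrite (prob_split (A (S n)) (A n)), Rplus_comm by auto.
    f_equal. f_equal. apply pred_ext; intros x; firstorder.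
Qed.

Lemma prob_union_bound (A : nat -> X -> Prop) C : (forall n, B (A n)) ->
  (forall n, sum_f_R0 (fun i => mu (A i)) n <= C) -> mu (fun x => exists n, A n x) <= C.
Proof.
  intros HA HC.
  set (U := fix U n := match n with O => A O | S m => fun x => U m x \/ A (S m) x end).
  assert (HU : forall n, B (U n)).
  { induction n; simpl; auto. apply sigma_or; auto. }
  assert (HUle : forall n, mu (U n) <= sum_f_R0 (fun i => mu (A i)) n).
  { induction n; simpl; [lra|].
    eapply Rle_trans; [apply prob_subadd; auto|]. lra. }
  replace (fun x => exists n, A n x) with (fun x => exists n, U n x).
  2:{ apply pred_ext; intros x; split; intros [n Hn].
      - induction n; simpl in Hn; [eauto|]. destruct Hn; eauto.
      - exists n; destruct n; simpl; auto. }
  eapply Un_cv_le_const with (N := 0%nat); [apply prob_continuity; auto|].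
  - intros n x; simpl; auto.
  - intros n _; cbv beta. eapply Rle_trans; eauto.
Qed.

Lemma prob_disjoint_sum (A : nat -> X -> Prop) n : (forall i, B (A i)) ->
  (forall i j x, (i < j < n)%nat -> A i x -> A j x -> False) ->
  rsum (fun i => mu (A i)) n <= 1.
Proof.
  intros HA Hd.
  cut (forall m, (m <= n)%nat -> B (fun x => exists i, (i < m)%nat /\ A i x) /\
      rsum (fun i => mu (A i)) m = mu (fun x => exists i, (i < m)%nat /\ A i x)).
  { intros H; destruct (H n) as [H1 ->]; auto. apply prob_le_1; auto. }
  induction m; intros Hm.
  - replace (fun x => exists i, (i < 0)%nat /\ A i x) with (fun _ : X => False).
    + split; [apply sigma_empty; auto|]. cbn [rsum]. symmetry; apply prob_empty.
    + apply pred_ext; intros x; split; [tauto|intros [i [Hi _]]; lia].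
  - destruct IHm as [H1 H2]; [lia|].
    replace (fun x => exists i, (i < S m)%nat /\ A i x) with
      (fun x => (exists i, (i < m)%nat /\ A i x) \/ A m x).
    + split; [apply sigma_or; auto|]. cbn [rsum]. rewrite H2, prob_add; auto.
      intros x (i & Hi & Hx) Hx'. apply (Hd i m x); auto; lia.
    + apply pred_ext; intros x; split.
      * intros [(i & Hi & Hx)|Hx]; eauto.
      * intros (i & Hi & Hx). destruct (Nat.eq_dec i m) as [->|]; auto.
        left; exists i; split; auto; lia.
Qed.

(** Splitting on membership in the last event reduces a superlevel set of a visit count to set
    operations, without measurable functions or integrals. *)
Lemma sigma_ge_sum_indic (E : nat -> X -> Prop) n : (forall i, B (E i)) -> forall c,
  B (fun x => c <= rsum (fun i => indic (E i) x) n).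
Proof.
  intros HE; induction n; intros c; cbn [rsum].
  - apply sigma_const; auto.
  - replace (fun x => c <= rsum (fun i => indic (E i) x) n + indic (E n) x) with
     (fun x => (E n x /\ c - 1 <= rsum (fun i => indic (E i) x) n) \/
               (~ E n x /\ c <= rsum (fun i => indic (E i) x) n)).
    + apply sigma_or; auto; apply sigma_and; auto. apply sigma_compl; auto.
    + apply pred_ext; intros x. destruct (classic (E n x)) as [H|H].
      * rewrite (indic_1 _ _ H). split; [intros [[]|[]]; [lra|tauto]|].
        intros; left; split; auto; lra.
      * rewrite (indic_0 _ _ H). split; [intros [[]|[]]; [tauto|lra]|].
        intros; right; split; auto; lra.
Qed.

(* Markov's inequality for a sum of indicators, by splitting [S] along the last event. *)
Lemma prob_markov (E : nat -> X -> Prop) n : (forall i, B (E i)) -> forall S c, B S ->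
  (forall x, S x -> c <= rsum (fun i => indic (E i) x) n) ->
  c * mu S <= rsum (fun i => mu (fun x => S x /\ E i x)) n.
Proof.
  intros HE; induction n; intros S c HS Hc; cbn [rsum] in *.
  - destruct (classic (exists x, S x)) as [[x Hx]|H].
    + specialize (Hc x Hx). pose proof (prob_nonneg S HS). nra.
    + replace S with (fun _ : X => False) by (apply pred_ext; firstorder).
      rewrite prob_empty; lra.
  - assert (HS1 : B (fun x => S x /\ E n x)) by (apply sigma_and; auto).
    assert (HS2 : B (fun x => S x /\ ~ E n x)) by (apply sigma_and, sigma_compl; auto).
    specialize (IHn (fun x => S x /\ E n x) (c - 1) HS1) as I1.
    specialize (IHn (fun x => S x /\ ~ E n x) c HS2) as I2.
    assert (Hsum : rsum (fun i => mu (fun x => S x /\ E i x)) n =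
      rsum (fun i => mu (fun x => (S x /\ E n x) /\ E i x)) n +
      rsum (fun i => mu (fun x => (S x /\ ~ E n x) /\ E i x)) n).
    { clear - HB HE HS Hp. generalize (E n) (HE n); intros D HD.
      induction n; cbn [rsum]; [ring|]. rewrite IHn.
      rewrite (prob_split (fun x => S x /\ E n x) D); auto; [|apply sigma_and; auto].
      replace (fun x => (S x /\ E n x) /\ D x) with (fun x => (S x /\ D x) /\ E n x)
        by (apply pred_ext; tauto).
      replace (fun x => (S x /\ E n x) /\ ~ D x) with (fun x => (S x /\ ~ D x) /\ E n x)
        by (apply pred_ext; tauto).
      ring. }
    rewrite Hsum, (prob_split S (E n)) by auto.
    assert (forall x, S x /\ E n x -> c - 1 <= rsum (fun i => indic (E i) x) n).
    { intros x [Hx He]. specialize (Hc x Hx). rewrite (indic_1 _ _ He) in Hc. lra. }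
    assert (forall x, S x /\ ~ E n x -> c <= rsum (fun i => indic (E i) x) n).
    { intros x [Hx He]. specialize (Hc x Hx). rewrite (indic_0 _ _ He) in Hc. lra. }
    specialize (I1 H); specialize (I2 H0). lra.
Qed.

End Probability.

(** An interface for Lebesgue measure on the unit interval: [M] lives on the whole line and [mu A]
    stands for the length of the part of [A] in [[0, 1)]. Hence invariance is stated for 1-periodic
    sets only. *)
Definition rotation_measure (M : (R -> Prop) -> Prop) (mu : (R -> Prop) -> R) : Prop :=
  is_probability_space M mu /\
  (forall a b, M (fun x => a < x /\ x < b)) /\
  (forall A t, M A -> M (fun x => A (x + t))) /\
  (forall A t, M A -> (forall x, A (x + 1) <-> A x) -> 0 <= t < 1 ->
     mu (fun x => A (x + t)) = mu A) /\
  (forall a b, a <= b -> mu (fun x => a < x /\ x < b) <= b - a).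

(** * Rotations of the circle *)

Definition periodized (a b x : R) : Prop := exists w : Z, a < x - IZR w /\ x - IZR w < b.

(** The Borel sets of the circle [R/Z], represented as 1-periodic subsets of the line. A rotation is
    then plain addition, and the flow laws are ring identities. *)
Definition circle_sets : (R -> Prop) -> Prop :=
  generated_sigma (fun S => exists a b, forall x, S x <-> periodized a b x).

Lemma circle_sets_sigma : is_sigma_algebra circle_sets.
Proof. apply generated_sigma_algebra. Qed.

Lemma circle_sets_periodized a b : circle_sets (periodized a b).
Proof. apply generated_sigma_gen; exists a, b; tauto. Qed.

Lemma circle_sets_shift t A : circle_sets A -> circle_sets (fun x => A (x + t)).
Proof.
  apply (generated_sigma_preimage _ _ (fun x => x + t)); [apply circle_sets_sigma|].
  intros S (a & b & HS). apply generated_sigma_gen; exists (a - t), (b - t).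
  intros x; rewrite HS. unfold periodized; split; intros [w Hw]; exists w; lra.
Qed.

Lemma circle_sets_periodic A : circle_sets A -> forall w x, A (x + IZR w) <-> A x.
Proof.
  intros HA. apply (HA (fun A => forall w x, A (x + IZR w) <-> A x)).
  - split; [|split].
    + tauto.
    + intros C HC w x. rewrite (HC w x). tauto.
    + intros C HC w x. split; intros [n Hn]; exists n; apply (HC n w x); auto.
  - intros S (a & b & HS) w x. rewrite !HS. unfold periodized; split; intros [v Hv].
    + exists (v - w)%Z. rewrite minus_IZR. lra.
    + exists (v + w)%Z. rewrite plus_IZR. lra.
Qed.

Lemma frac_part_exists x : exists w : Z, 0 <= x - IZR w < 1.
Proof.
  exists (up x - 1)%Z. rewrite minus_IZR. destruct (archimed x); lra.
Qed.

Section Rotation.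
Context (M : (R -> Prop) -> Prop) (mu : (R -> Prop) -> R).
Hypothesis Hrot : rotation_measure M mu.

Lemma circle_sets_measurable A : circle_sets A -> M A.
Proof.
  destruct Hrot as ([HM _] & Hint & _).
  intros HA; apply HA; auto.
  intros S (a & b & HS).
  replace S with (fun x => exists w, a + IZR w < x /\ x < b + IZR w).
  - apply (sigma_exists_Z M HM (fun w x => a + IZR w < x /\ x < b + IZR w)); auto.
  - apply pred_ext; intros x; rewrite HS; unfold periodized; split; intros [w Hw]; exists w; lra.
Qed.

Lemma circle_probability : is_probability_space circle_sets mu.
Proof.
  destruct Hrot as ((_ & H1 & H2 & H3) & _).
  split; [apply circle_sets_sigma|split; [|split]]; auto.
  - intros A HA; apply H1, circle_sets_measurable; auto.
  - intros A HA Hd; apply H3; auto. intros n; apply circle_sets_measurable; auto.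
Qed.

(** Periodicity reduces [t] to its fractional part. *)
Lemma rotation_invariant A t : circle_sets A -> mu (fun x => A (x + t)) = mu A.
Proof.
  intros HA. destruct (frac_part_exists t) as [w Hw].
  replace (fun x => A (x + t)) with (fun x => A (x + (t - IZR w))).
  - destruct Hrot as (_ & _ & _ & H & _). apply H; auto.
    + apply circle_sets_measurable; auto.
    + intros x; apply (circle_sets_periodic A HA 1).
  - apply pred_ext; intros x. rewrite <- (circle_sets_periodic A HA w).
    replace (x + (t - IZR w) + IZR w) with (x + t) by ring. tauto.
Qed.

Lemma rotation_jointly_measurable lam C : 0 < lam -> circle_sets C ->
  borel_prod circle_sets (fun p : R * R => C (snd p + lam * fst p)).
Proof.
  intros Hlam. unfold borel_prod.
  apply (generated_sigma_preimage _ _ (fun p : R * R => snd p + lam * fst p));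
    [apply generated_sigma_algebra|].
  intros D (a & b & HS).
  set (G := generated_sigma _).
  assert (HG : is_sigma_algebra G) by apply generated_sigma_algebra.
  (* The preimage of an arc is a countable union of rectangles. While [lam * t] runs through the
     window from [(i - 1) / (n + 1)] to [(i + 1) / (n + 1)], the arc for [x] is shrunk so that the
     rotated point stays in the original arc. Neighbouring windows overlap, so open ones cover all
     times. *)
  set (T := fun (n : nat) (i : Z) (p : R * R) =>
    (IZR (i - 1) / (INR (S n) * lam) < fst p /\ fst p < IZR (i + 1) / (INR (S n) * lam)) /\
    periodized (a - IZR (i - 1) / INR (S n)) (b - IZR (i + 1) / INR (S n)) (snd p)).
  replace (fun p => D (snd p + lam * fst p)) with (fun p => exists n i, T n i p).
  - apply (sigma_exists G HG (fun n p => exists i, T n i p)); intros n.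
    apply (sigma_exists_Z G HG (T n)); intros i.
    apply generated_sigma_gen.
    exists (fun t => IZR (i - 1) / (INR (S n) * lam) < t /\ t < IZR (i + 1) / (INR (S n) * lam)).
    exists (periodized (a - IZR (i - 1) / INR (S n)) (b - IZR (i + 1) / INR (S n))).
    split; [|split; [apply circle_sets_periodized|unfold T; tauto]].
    apply generated_sigma_gen. eexists; eexists; intros; reflexivity.
  - apply pred_ext; intros [t x]; cbn [fst snd]. rewrite HS.
    split.
    + intros (n & i & [H1 H2] & w & H3 & H4). cbn [fst snd] in *. exists w.
      assert (Hn : 0 < INR (S n)) by (apply lt_0_INR; lia).
      assert (IZR (i - 1) / INR (S n) < lam * t /\ lam * t < IZR (i + 1) / INR (S n)); [|lra].
      apply Rmult_lt_compat_l with (r := lam) in H1, H2; auto.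
      replace (lam * (IZR (i - 1) / (INR (S n) * lam))) with (IZR (i - 1) / INR (S n)) in H1 by (field; lra).
      replace (lam * (IZR (i + 1) / (INR (S n) * lam))) with (IZR (i + 1) / INR (S n)) in H2 by (field; lra).
      auto.
    + intros (w & H1 & H2).
      set (y := x + lam * t - IZR w) in *.
      set (g := Rmin (y - a) (b - y)).
      assert (0 < g) by (apply Rmin_pos; lra).
      assert (g <= y - a /\ g <= b - y) by (split; [apply Rmin_l|apply Rmin_r]).
      (* The window width [2 / (n + 1)] must be below the distance [g] of the rotated point to the
         ends of the arc. *)
      destruct (INR_unbounded (2 / g)) as [n Hn].
      assert (Hn0 : 0 < INR (S n)) by (apply lt_0_INR; lia).
      assert (Hg : 2 / INR (S n) < g).
      { apply Rmult_lt_reg_r with (INR (S n)); auto.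
        unfold Rdiv; rewrite Rmult_assoc, Rinv_l, Rmult_1_r by lra.
        apply Rmult_lt_compat_r with (r := g) in Hn; auto.
        unfold Rdiv in Hn; rewrite Rmult_assoc, Rinv_l, Rmult_1_r in Hn by lra.
        rewrite S_INR; lra. }
      set (v := lam * t * INR (S n)).
      destruct (frac_part_exists v) as [i Hi].
      assert (Hv : lam * t = v / INR (S n)) by (unfold v; field; lra).
      assert (Hd : forall p q, p < q -> p / INR (S n) < q / INR (S n)).
      { intros; apply Rmult_lt_compat_r; auto. apply Rinv_0_lt_compat; auto. }
      assert (D1 : IZR (i - 1) / INR (S n) < lam * t) by (rewrite Hv, minus_IZR; apply Hd; lra).
      assert (D2 : lam * t < IZR (i + 1) / INR (S n)) by (rewrite Hv, plus_IZR; apply Hd; lra).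
      assert (D3 : IZR (i + 1) / INR (S n) = IZR (i - 1) / INR (S n) + 2 / INR (S n))
        by (rewrite plus_IZR, minus_IZR; field; lra).
      exists n, i; split; cbn [fst snd].
      * split.
        -- apply Rmult_lt_reg_l with lam; auto.
           replace (lam * (IZR (i - 1) / (INR (S n) * lam))) with (IZR (i - 1) / INR (S n)) by (field; lra).
           auto.
        -- apply Rmult_lt_reg_l with lam; auto.
           replace (lam * (IZR (i + 1) / (INR (S n) * lam))) with (IZR (i + 1) / INR (S n)) by (field; lra).
           auto.
      * exists w. unfold y in *. lra.
Qed.

Lemma rotation_flow lam : 0 < lam -> is_mp_flow circle_sets mu (fun t x => x + lam * t).
Proof.
  intros Hlam; split; [|split; [|split]].
  - intros C HC; apply rotation_jointly_measurable; auto.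
  - intros; ring.
  - intros; ring.
  - intros t C HC; split; [apply circle_sets_shift|apply rotation_invariant]; auto.
Qed.

Lemma geometric_half_sum n : sum_f_R0 (fun i => (/ 2) ^ i) n <= 2.
Proof.
  assert (H : sum_f_R0 (fun i => (/ 2) ^ i) n = 2 - (/ 2) ^ n) by (induction n; simpl in *; lra).
  pose proof (pow_le (/ 2) n); lra.
Qed.

(** An enumeration would cover the line by intervals of lengths [(/ 2) ^ n / 4], hence of total
    measure at most 1/2, whereas the whole space has measure 1. *)
Lemma reals_not_enumerable (v : nat -> R) : exists x, forall n, x <> v n.
Proof.
  apply NNPP; intro H.
  assert (Hall : forall x, exists n, x = v n).
  { intros x. apply NNPP; intro H'. apply H; exists x; intros n ->; eauto. }
  destruct Hrot as (HP & Hint & _ & _ & Hlen).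
  set (A := fun n x => v n - (/ 2) ^ n / 8 < x /\ x < v n + (/ 2) ^ n / 8).
  assert (mu (fun x => exists n, A n x) <= / 2).
  { apply (prob_union_bound M mu HP).
    - intros n; apply Hint.
    - intros n. apply Rle_trans with (/ 4 * sum_f_R0 (fun i => (/ 2) ^ i) n).
      + rewrite scal_sum. apply sum_Rle; intros i _.
        assert (0 < (/ 2) ^ i) by (apply pow_lt; lra).
        eapply Rle_trans; [apply Hlen; lra|lra].
      + pose proof (geometric_half_sum n); lra. }
  replace (fun x => exists n, A n x) with (fun _ : R => True) in H0.
  - rewrite (prob_full M mu HP) in H0; lra.
  - apply pred_ext; intros x; split; auto. intros _.
    destruct (Hall x) as [n ->]. exists n; unfold A.
    assert (0 < (/ 2) ^ n) by (apply pow_lt; lra). lra.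
Qed.

End Rotation.

(** * Lebesgue measure on the unit interval *)

Module Lebesgue.

Import HB.structures.
Import all_boot all_order all_algebra.
Import boolp classical_sets reals ereal normedtype measure lebesgue_measure
  measurable_realfun Rstruct.
Import Order.TTheory GRing.Theory Num.Theory numFieldNormedType.Exports.

Local Open Scope classical_set_scope.
Local Open Scope ring_scope.

Section Circle.
Variable T : realType.
Local Notation leb := (@lebesgue_measure T).

Lemma preimage_shift_itv (b1 b2 : bool) (a b t : T) :
  (fun x : T => x + t) @^-1` [set` Interval (BSide b1 a) (BSide b2 b)] =
  [set` Interval (BSide b1 (a - t)) (BSide b2 (b - t))].
Proof.
by apply/seteqP; split=> x /=; rewrite !in_itv /=; case: b1; case: b2 => /=;
  rewrite ?(lerBlDr, ltrBlDr, lerBrDr, ltrBrDr).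
Qed.

Lemma measurable_shift (t : T) :
  measurable_fun setT (fun x : measurableTypeR T => (x + t : measurableTypeR T)).
Proof. by apply: measurable_funD => //; exact: measurable_cst. Qed.

Lemma measurable_preimage_shift (A : set (measurableTypeR T)) (t : T) :
  measurable A -> measurable ((fun x : T => x + t) @^-1` A : set (measurableTypeR T)).
Proof.
by move=> mA; rewrite -[X in measurable X]setTI; exact: (measurable_shift t).
Qed.

(** The image of Lebesgue measure under the shift agrees with it on half-open intervals, and these
    determine the measure. *)
Lemma lebesgue_shift (A : set (measurableTypeR T)) (t : T) : measurable A ->
  leb ((fun x : T => x + t) @^-1` A) = leb A.
Proof.
move=> mA; apply/esym.
pose f : {mfun measurableTypeR T >-> measurableTypeR T} :=
  HB.pack_for {mfun measurableTypeR T >-> measurableTypeR T} (fun x : measurableTypeR T => (x + t : measurableTypeR T))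
    (isMeasurableFun.Build _ _ _ _ _ (measurable_shift t)).
have := @lebesgue_measure_unique T (pushforward leb f).
apply => // X [[a b] _ <-].
rewrite /= /pushforward preimage_shift_itv !lebesgue_measure_itv /= !lte_fin.
by rewrite ltrD2r -!EFinD opprB addrA addrNK.
Qed.

(** Shifting replaces the window [[0, 1)] by [[t, 1 + t)]. Cut this at 1 and move the piece over
    [[1, 1 + t)] back to [[0, t)] by periodicity of [A]. *)
Lemma lebesgue_rotation (A : set (measurableTypeR T)) (t : T) : measurable A ->
  (forall x, A (x + 1) <-> A x) -> 0 <= t -> t < 1 ->
  leb ((fun x : T => x + t) @^-1` A `&` `[0, 1[) = leb (A `&` `[0, 1[).
Proof.
move=> mA pA t0 t1.
have -> : (fun x : T => x + t) @^-1` A `&` `[0, 1[ =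
    (fun x : T => x + t) @^-1` (A `&` `[t, 1 + t[).
  by rewrite preimage_setI preimage_shift_itv subrr addrK.
have mI (a b : T) : measurable (A `&` `[a, b[ : set (measurableTypeR T)).
  by apply: measurableI => //; exact: measurable_itv.
rewrite lebesgue_shift//.
have split_at (a b c : T) : a <= b -> b <= c ->
    leb (A `&` `[a, c[) = (leb (A `&` `[a, b[) + leb (A `&` `[b, c[))%E.
  move=> ab bc; rewrite -measureU//; last first.
    apply/seteqP; split => // x [[_ /=]]; rewrite !in_itv /=.
    move=> /andP[_ xb] [_ /andP[bx _]].
    by move: (lt_le_trans xb bx); rewrite ltxx.
  congr (leb _); rewrite -setIUr; congr (_ `&` _).
  apply/seteqP; split => x /=; rewrite !in_itv /=.
    move=> /andP[ax xc]; case: (ltP x b) => xb; [left|right].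
      by rewrite ax.
    by rewrite /= xc ?xb.
  move=> [/andP[ax xb]|/andP[bx xc]]; apply/andP; split => //.
    exact: lt_le_trans bc.
  exact: le_trans bx.
rewrite (split_at t 1) ?lerDl ?(ltW t1)// (split_at 0 t 1) ?(ltW t1)//.
rewrite addeC; congr (_ + _)%E.
rewrite -[RHS](lebesgue_shift _ (-1))//; congr (leb _).
apply/seteqP; split => x /=; rewrite !in_itv /= => -[Ax xI]; split.
- by apply/pA; rewrite addrNK.
- by move: xI; rewrite subr_ge0 ltrBlDr addrC.
- by have := pA (x - 1); rewrite addrNK => -[_]; exact.
- by move: xI; rewrite subr_ge0 ltrBlDr addrC.
Qed.

End Circle.

Section RotationMeasure.
Local Notation leb := (@lebesgue_measure R).
Local Notation I01 := (`[(0 : R), (1 : R)[%classic : set R).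

Definition lebesgue_measurable (A : R -> Prop) : Prop :=
  measurable (A : set (measurableTypeR R)).

Definition lebesgue_unit (A : R -> Prop) : R := fine (leb ((A : set R) `&` I01)).

Lemma open_itvE (a b : R) :
  (fun x : R => Rlt a x /\ Rlt x b) = (`]a, b[%classic : set R).
Proof.
apply/seteqP; split => x /=; rewrite in_itv /=.
  by move=> [/RltP -> /RltP ->].
by move=> /andP[/RltP ? /RltP ?].
Qed.

Lemma lebesgue_I01 : leb I01 = 1%E.
Proof. by rewrite lebesgue_measure_itv /= lte_fin ltr01 oppr0 adde0. Qed.

Lemma measurable_I01 (A : set (measurableTypeR R)) : measurable A ->
  measurable (A `&` I01 : set (measurableTypeR R)).
Proof. by move=> mA; apply: measurableI => //; exact: measurable_itv. Qed.

Lemma lebesgue_unit_le1 (A : set (measurableTypeR R)) : measurable A ->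
  (leb (A `&` I01) <= 1)%E.
Proof.
move=> mA; rewrite -lebesgue_I01; apply: le_measure; rewrite ?inE.
- exact: measurable_I01.
- exact: measurable_itv.
- by move=> x [].
Qed.

Lemma lebesgue_unitE (A : set (measurableTypeR R)) : measurable A ->
  leb (A `&` I01) = (lebesgue_unit A)%:E.
Proof.
move=> mA; rewrite /lebesgue_unit fineK// ge0_fin_numE ?measure_ge0//.
by apply: le_lt_trans (lebesgue_unit_le1 _ mA) _; rewrite ltry.
Qed.

Lemma lebesgue_rotation_measure : rotation_measure lebesgue_measurable lebesgue_unit.
Proof.
split; [split|split; [|split; [|split]]].
- split; [exact: measurableT|split].
    by move=> A mA; exact: (measurableC mA).
  move=> An mAn; rewrite /lebesgue_measurable.
  rewrite (_ : (fun _ => _) = \bigcup_n (An n : set (measurableTypeR R))).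
    exact: bigcupT_measurable.
  by apply/seteqP; split => x [n] => [|_] Ax; exists n.
- split; [|split].
  + move=> A mA; apply/RleP; apply: fine_ge0; exact: measure_ge0.
  + by rewrite /lebesgue_unit setTI lebesgue_I01.
  + move=> An mAn dAn eps /RltP eps0.
    pose F n : set (measurableTypeR R) := (An n : set R) `&` I01.
    have mF n : measurable (F n) by apply: measurable_I01; exact: mAn.
    have UF : \bigcup_n F n = ((fun x => exists n, An n x) : set R) `&` I01.
      apply/seteqP; split => [x [n _ [Ax xI]]|x [[n Ax] xI]].
        by split => //; exists n.
      by exists n.
    have mUA : measurable ((fun x => exists n, An n x) : set (measurableTypeR R)).
      rewrite (_ : (fun _ => _) = \bigcup_n (An n : set (measurableTypeR R))).
        exact: bigcupT_measurable.
      by apply/seteqP; split => x [n] => [|_] Ax; exists n.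
    have tF : trivIset setT F.
      apply/trivIsetP => i j _ _ /eqP ij; apply/seteqP; split => // x [[Aix _] [Ajx _]].
      exact: (dAn _ _ x ij Aix Ajx).
    have : (fun n => \sum_(0 <= i < n) leb (F i))%E @ \oo --> leb (\bigcup_n F n).
      exact: (@measure_semi_sigma_additive _ _ _ leb F mF tF (bigcupT_measurable _ mF)).
    rewrite UF lebesgue_unitE//.
    rewrite (_ : (fun n => _) = EFin \o (fun n => \sum_(0 <= i < n) lebesgue_unit (An i))).
      move=> /fine_cvg /cvgrPdist_lt /(_ eps eps0) [N _ HN].
      exists N => n /ssrnat.leP Nn; rewrite RdistE sum_f_R0E distrC; apply/RltP.
      (* [sum_f_R0] includes its upper index, so it matches the big sum over [n.+1] terms. *)
      by apply: (HN n.+1); exact: leqW.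
    apply/funext => n /=; rewrite -sumEFin; apply: eq_bigr => i _.
    by rewrite lebesgue_unitE//; exact: mAn.
- move=> a b; rewrite /lebesgue_measurable.
  by rewrite open_itvE; exact: measurable_itv.
- by move=> A t mA; exact: measurable_preimage_shift.
- move=> A t mA pA [/RleP t0 /RltP t1].
  by rewrite /lebesgue_unit; congr fine; exact: (lebesgue_rotation R A t mA pA t0 t1).
- move=> a b /RleP ab.
  have mab : measurable (`]a, b[%classic : set (measurableTypeR R)) by exact: measurable_itv.
  rewrite open_itvE.
  apply/RleP; rewrite -lee_fin -lebesgue_unitE//.
  apply: (@le_trans _ _ (leb `]a, b[)).
    by apply: le_measure; rewrite ?inE//; exact: measurable_I01.
  rewrite lebesgue_measure_itv /= lte_fin; case: ifPn => // _.
  by rewrite lee_fin subr_ge0.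
Qed.

End RotationMeasure.

End Lebesgue.

(** * Independent sequences are not pointwise good *)

Lemma rsum_ge_count (g : nat -> R) p n : (forall i, 0 <= g i) ->
  (forall i, (p <= i < n)%nat -> g i = 1) -> INR n - INR p <= rsum g n.
Proof.
  intros Hg H1; induction n; cbn [rsum].
  - pose proof (pos_INR p); simpl; lra.
  - rewrite S_INR. destruct (Nat.le_gt_cases p n).
    + rewrite (H1 n) by lia. specialize (IHn ltac:(intros; apply H1; lia)). lra.
    + assert (0 <= rsum g n) by (clear -Hg; induction n; cbn [rsum]; [lra|specialize (Hg n); lra]).
      specialize (Hg n). assert (INR (S n) <= INR p) by (apply le_INR; lia).
      rewrite S_INR in *; lra.
Qed.

Lemma rsum_sum_f_R0 g n : rsum g (S n) = sum_f_R0 g n.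
Proof. induction n; cbn [rsum sum_f_R0] in *; [ring|now rewrite <- IHn]. Qed.

Lemma rsum_const c n : rsum (fun _ => c) n = INR n * c.
Proof. induction n; cbn [rsum]; [simpl; ring|rewrite IHn, S_INR; ring]. Qed.

Lemma rsum_le g h n : (forall i, g i <= h i) -> rsum g n <= rsum h n.
Proof. intros H; induction n; cbn [rsum]; [lra|specialize (H n); lra]. Qed.

Definition narrow (m s : nat) (x : R) : Prop :=
  periodized (- / INR (2 * m)) (/ INR (2 * m)) (INR s * x).

Lemma narrow_periodized m s : (0 < m)%nat -> (0 < s)%nat -> circle_sets (narrow m s).
Proof.
  intros Hm Hs. assert (Hs' : 0 < INR s) by (apply lt_0_INR; auto).
  set (h := / INR (2 * m)).
  replace (narrow m s) with (fun x => exists i : Z,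
    periodized ((IZR i - h) / INR s) ((IZR i + h) / INR s) x).
  - apply (sigma_exists_Z _ circle_sets_sigma (fun i => periodized ((IZR i - h) / INR s) ((IZR i + h) / INR s))).
    intros; apply circle_sets_periodized.
  - assert (Hsc : forall u y, u / INR s < y <-> u < INR s * y).
    { intros u y; split; intros H.
      - apply Rmult_lt_compat_l with (r := INR s) in H; auto.
        replace (INR s * (u / INR s)) with u in H by (field; lra). auto.
      - apply Rmult_lt_reg_l with (INR s); auto.
        replace (INR s * (u / INR s)) with u by (field; lra). auto. }
    assert (Hsc' : forall u y, y < u / INR s <-> INR s * y < u).
    { intros u y; split; intros H.
      - apply Rmult_lt_compat_l with (r := INR s) in H; auto.
        replace (INR s * (u / INR s)) with u in H by (field; lra). auto.
      - apply Rmult_lt_reg_l with (INR s); auto.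
        replace (INR s * (u / INR s)) with u by (field; lra). auto. }
    apply pred_ext; intros x; unfold narrow, periodized; fold h; split.
    + intros (i & w & H1 & H2). apply Hsc in H1; apply Hsc' in H2.
      exists (i + Z.of_nat s * w)%Z. rewrite plus_IZR, mult_IZR, <- INR_IZR_INZ. lra.
    + intros (i & H1 & H2). exists i, 0%Z. rewrite Hsc, Hsc'. lra.
Qed.

(* The [m] translates of [narrow m s] by multiples of [1 / (m s)] are disjoint. *)
Lemma narrow_measure M mu m s : rotation_measure M mu -> (0 < m)%nat -> (0 < s)%nat ->
  mu (narrow m s) <= / INR m.
Proof.
  intros Hrot Hm Hs.
  assert (Hm' : 0 < INR m) by (apply lt_0_INR; auto).
  assert (Hs' : 0 < INR s) by (apply lt_0_INR; auto).
  pose proof (narrow_periodized m s Hm Hs) as Hc.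
  pose proof (circle_probability M mu Hrot) as HP.
  pose proof (prob_disjoint_sum circle_sets mu HP
    (fun r x => narrow m s (x + INR r / (INR m * INR s))) m) as H.
  cbv beta in H.
  replace (fun r => mu (fun x => narrow m s (x + INR r / (INR m * INR s)))) with
    (fun _ : nat => mu (narrow m s)) in H.
  2:{ apply functional_extensionality; intros r. symmetry.
      apply (rotation_invariant M mu Hrot (narrow m s)); auto. }
  rewrite rsum_const in H.
  apply Rmult_le_reg_l with (INR m); auto. rewrite Rinv_r by lra. apply H; clear H.
  - intros r; apply circle_sets_shift; auto.
  - intros i j x Hij [w Hw] [v Hv].
    rewrite mult_INR in Hw, Hv. change (INR 2) with 2 in Hw, Hv.
    assert (E : forall r, INR s * (x + INR r / (INR m * INR s)) = INR s * x + INR r / INR m)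
      by (intros; field; lra).
    rewrite E in Hw, Hv.
    assert (H1 : - / INR m < (INR j - INR i) / INR m - IZR (v - w) < / INR m).
    { rewrite minus_IZR. replace (/ INR m) with (/ (2 * INR m) + / (2 * INR m)) by (field; lra).
      replace ((INR j - INR i) / INR m) with (INR j / INR m - INR i / INR m) by (field; lra).
      lra. }
    (* A common point of translates [i < j] puts [j - i] at distance less than 1 from a multiple of
       [m]. Being integers they coincide, impossible for [0 < j - i < m]. *)
    assert (H2 : -1 < (INR j - INR i) - IZR (v - w) * INR m < 1).
    { destruct H1 as [H1 H2].
      apply Rmult_lt_compat_r with (r := INR m) in H1, H2; auto.
      replace (- / INR m * INR m) with (-1) in H1 by (field; lra).
      replace (/ INR m * INR m) with 1 in H2 by (field; lra).
      replace (((INR j - INR i) / INR m - IZR (v - w)) * INR m) with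
        (INR j - INR i - IZR (v - w) * INR m) in H1, H2 by (field; lra).
      lra. }
    rewrite !INR_IZR_INZ, <- minus_IZR, <- mult_IZR, <- minus_IZR in H2.
    destruct H2 as [H2 H3]. apply lt_IZR in H2, H3.
    destruct (Z_le_dec (v - w) 0); nia.
Qed.

(* Kronecker's theorem makes the orbit of [s * b k] sit near [- i / (4 m)] throughout the
   [i]-th dyadic block of indices, so every point falls in the narrow set during half of the time up to
   the end of some block. *)
Lemma narrow_sweep (b : nat -> R) m j : (forall K, independent_with_one b K) -> (0 < m)%nat ->
  exists s, (0 < s)%nat /\ forall x, exists n, (j <= n)%nat /\
    INR (S n) / 2 <= rsum (fun k => indic (narrow m s) (x + b k)) (S n).
Proof.
  intros Hind Hm.
  set (L := (4 * m)%nat).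
  assert (Hm' : 1 <= INR m) by (change 1 with (INR 1); apply le_INR; lia).
  assert (HL : INR L = 4 * INR m) by (unfold L; rewrite mult_INR; simpl (INR 4); ring).
  (* Block [i] consists of the [k] with [S j * 2 ^ i <= S k < S j * 2 ^ S i]; starting at scale
     [S j] forces the time found below to be at least [j]. *)
  set (block := fun k => Nat.log2 (S k / S j)).
  set (K := (S j * 2 ^ L)%nat).
  (* Subtracting [b k] from the target turns the multiplier [s] into [S s], which is positive. *)
  destruct (kronecker b (fun k => - INR (block k) / INR L - b k) K (/ INR L) (Hind K)) as [s Hs].
  { rewrite HL; split; [apply Rinv_0_lt_compat; lra|]. apply Rinv_le_contravar; lra. }
  exists (S s); split; [lia|]. intros x.
  destruct (frac_part_exists (INR (S s) * x)) as [z Hz].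
  set (y := INR (S s) * x - IZR z) in *.
  (* [iz] is the cell of length [1 / L] containing the fractional part [y] of [S s * x]. During
     block [iz] the point is within [1 / L + 1 / L = 1 / (2 * m)] of an integer. *)
  destruct (frac_part_exists (y * INR L)) as [iz Hiz].
  assert (Hrange : (0 <= iz < Z.of_nat L)%Z).
  { assert (0 <= y * INR L < INR L) by nra.
    assert (IZR (-1) < IZR iz) by lra.
    assert (IZR iz < IZR (Z.of_nat L)) by (rewrite <- INR_IZR_INZ; lra).
    apply lt_IZR in H0, H1. lia. }
  set (i := Z.to_nat iz).
  assert (Hi : IZR iz = INR i) by (unfold i; rewrite INR_IZR_INZ, Z2Nat.id by lia; auto).
  rewrite Hi in Hiz.
  assert (HiL : (i < L)%nat) by (unfold i; lia).
  assert (H2i : (1 <= 2 ^ i)%nat) by (pose proof (Nat.pow_nonzero 2 i); lia).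
  assert (HiL2 : (2 * 2 ^ i <= 2 ^ L)%nat).
  { change (2 * 2 ^ i)%nat with (2 ^ S i)%nat. apply Nat.pow_le_mono_r; lia. }
  set (p := (S j * 2 ^ i)%nat).
  assert (Hpj : (S j <= p)%nat) by (unfold p; nia).
  (* Block [i] runs from [p - 1] to [2 * p - 2], so it supplies [p] of the first [2 * p - 1]
     terms. *)
  exists (2 * p - 2)%nat. split; [lia|].
  replace (S (2 * p - 2)) with (2 * p - 1)%nat by lia.
  apply Rle_trans with (INR (2 * p - 1) - INR (p - 1)).
  { rewrite !minus_INR, mult_INR by lia. change (INR 2) with 2; change (INR 1) with 1. lra. }
  apply rsum_ge_count; [intros; apply indic_bounds|].
  intros k Hk. apply indic_1.
  assert (Hb : block k = i).
  { unfold block. apply Nat.log2_unique; [lia|]. split.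
    - apply Nat.div_le_lower_bound; [lia|]. unfold p in Hk; lia.
    - apply Nat.Div0.div_lt_upper_bound. unfold p in Hk. cbn [Nat.pow]. lia. }
  destruct (Hs k) as [w Hw]; [unfold K; unfold p in Hk; nia|].
  rewrite Hb in Hw. exists (z + w)%Z.
  rewrite plus_IZR, mult_INR. change (INR 2) with 2.
  apply Rabs_def2 in Hw.
  assert (Hy : 0 <= y - INR i / INR L < / INR L).
  { assert (0 < INR L) by lra.
    replace (y - INR i / INR L) with ((y * INR L - INR i) * / INR L) by (field; lra).
    pose proof (Rinv_0_lt_compat _ H). split; [apply Rmult_le_pos; lra|].
    rewrite <- (Rmult_1_l (/ INR L)) at 2. apply Rmult_lt_compat_r; lra. }
  replace (/ (2 * INR m)) with (/ INR L + / INR L) by (rewrite HL; field; lra).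
  replace (INR (S s) * (x + b k) - (IZR z + IZR w)) with
    ((y - INR i / INR L) + (INR s * b k - (- INR i / INR L - b k) - IZR w))
    by (unfold y; rewrite S_INR; field; lra).
  lra.
Qed.

Theorem independent_not_pointwise_good M mu (a : nat -> R) lam :
  rotation_measure M mu -> 0 < lam ->
  (forall K, independent_with_one (fun k => lam * a (S k)) K) -> ~ pointwise_good a.
Proof.
  intros Hrot Hlam Hind Hgood.
  set (b := fun k => lam * a (S k)) in *.
  pose proof (circle_probability M mu Hrot) as HP.
  pose proof circle_sets_sigma as HC.
  assert (Hex : forall j, exists s, (0 < s)%nat /\ forall x, exists n, (j <= n)%nat /\
    INR (S n) / 2 <= rsum (fun k => indic (narrow (2 ^ (j + 4)) s) (x + b k)) (S n)).
  { intros j. apply narrow_sweep; auto. pose proof (Nat.pow_nonzero 2 (j + 4)); lia. }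
  apply functional_choice in Hex as [s Hs].
  (* The widths [2 ^ (j + 4)] give measures at most [(/ 2) ^ j / 16], with total at most 1/8. *)
  set (E := fun x => exists j, narrow (2 ^ (j + 4)) (s j) x).
  assert (Hpow : forall j, (0 < 2 ^ (j + 4))%nat) by (intros j; pose proof (Nat.pow_nonzero 2 (j + 4)); lia).
  assert (HEj : forall j, circle_sets (narrow (2 ^ (j + 4)) (s j))).
  { intros j; apply narrow_periodized; auto; apply Hs. }
  assert (HE : circle_sets E) by (apply (sigma_exists _ HC (fun j => narrow (2 ^ (j + 4)) (s j))); auto).
  assert (HmuE : mu E <= / 8).
  { apply (prob_union_bound circle_sets mu HP (fun j => narrow (2 ^ (j + 4)) (s j))); auto.
    intros n. apply Rle_trans with (/ 16 * sum_f_R0 (fun i => (/ 2) ^ i) n).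
    - rewrite scal_sum. apply sum_Rle; intros j _.
      eapply Rle_trans; [apply (narrow_measure M mu); auto; apply Hs|].
      rewrite pow_INR, pow_add, pow_inv, Rinv_mult. change (INR 2) with 2. simpl (2 ^ 4). lra.
    - pose proof (geometric_half_sum n); lra. }
  destruct (Hgood R circle_sets mu (fun t x => x + lam * t) (indic E) HP
    (rotation_flow M mu Hrot lam Hlam)) as (N & HN & HN0 & Hcv).
  { split.
    - intros A _.
      replace (fun x => A (indic E x)) with (fun x => (E x /\ A 1) \/ (~ E x /\ A 0)).
      + apply sigma_or; auto; apply sigma_and; auto;
          [apply sigma_const|apply sigma_compl|apply sigma_const]; auto.
      + apply pred_ext; intros x; destruct (classic (E x)) as [H|H];
          [rewrite (indic_1 _ _ H)|rewrite (indic_0 _ _ H)]; tauto.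
    - exists 1, (fun _ => False); split; [apply sigma_empty; auto|split].
      + apply (prob_empty circle_sets mu HP).
      + intros x _. pose proof (indic_bounds E x). rewrite Rabs_right; lra. }
  set (V := fun n x => rsum (fun k => indic E (x + b k)) (S n)).
  assert (HV : forall x n, erg_avg a (fun t x => x + lam * t) (indic E) x n = V n x / INR (S n)).
  { intros x n. unfold erg_avg, V, b. rewrite rsum_sum_f_R0. unfold Rdiv; ring. }
  assert (Hbig : forall x j, exists n, (j <= n)%nat /\ INR (S n) / 2 <= V n x).
  { intros x j. destruct (Hs j) as [_ H]. destruct (H x) as (n & Hn & Hn').
    exists n; split; auto. eapply Rle_trans; [apply Hn'|]. apply rsum_le; intros k.
    destruct (classic (narrow (2 ^ (j + 4)) (s j) (x + b k))) as [H'|H'].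
    - rewrite (indic_1 E); [apply indic_bounds|]. exists j; auto.
    - rewrite (indic_0 _ _ H'). apply indic_bounds. }
  (* The averages reach 1/2 at arbitrarily late times, so where they converge the limit exceeds 3/8
     and they eventually stay above 1/4. Hence the increasing sets [W m] exhaust the space up to a
     null set. *)
  set (W := fun m x => forall n, (m <= n)%nat -> INR (S n) / 4 <= V n x).
  assert (HW : forall m, circle_sets (W m)).
  { intros m. apply (sigma_forall _ HC (fun n x => (m <= n)%nat -> INR (S n) / 4 <= V n x)).
    intros n. destruct (Nat.le_gt_cases m n).
    - replace (fun x => (m <= n)%nat -> INR (S n) / 4 <= V n x) with
        (fun x => INR (S n) / 4 <= V n x) by (apply pred_ext; tauto).
      apply (sigma_ge_sum_indic circle_sets mu HP (fun k x => E (x + b k))).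
      intros k; apply circle_sets_shift; auto.
    - replace (fun x => (m <= n)%nat -> INR (S n) / 4 <= V n x) with (fun _ : R => True).
      + apply sigma_full; auto.
      + apply pred_ext; intros x; split; auto. intros; lia. }
  assert (HWfull : 1 <= mu (fun x => exists m, W m x)).
  { pose proof (sigma_exists _ HC W HW) as HWU.
    rewrite <- (prob_full circle_sets mu HP).
    replace (mu (fun x => exists m, W m x)) with (mu (fun x => exists m, W m x) + mu N) by lra.
    eapply Rle_trans; [|apply (prob_subadd circle_sets mu HP); auto].
    apply (prob_mono circle_sets mu HP); [apply sigma_full; auto|apply sigma_or; auto|].
    intros x _. destruct (classic (N x)) as [|Hx]; [right; auto|left].
    destruct (Hcv x Hx) as [l Hl].
    destruct (Hl (/ 8)) as [m Hm]; [lra|].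
    assert (Hq : forall n, 0 < INR (S n)) by (intros; apply lt_0_INR; lia).
    assert (Hl3 : 3 / 8 < l).
    { destruct (Hbig x m) as (n & Hn & Hn'). specialize (Hm n Hn). rewrite HV in Hm.
      unfold Rdist in Hm; apply Rabs_def2 in Hm. specialize (Hq n).
      assert (/ 2 <= V n x / INR (S n)); [|lra].
      apply Rmult_le_reg_r with (INR (S n)); auto.
      replace (V n x / INR (S n) * INR (S n)) with (V n x) by (field; lra). lra. }
    exists m; intros n Hn. specialize (Hm n Hn). rewrite HV in Hm.
    unfold Rdist in Hm; apply Rabs_def2 in Hm. specialize (Hq n).
    replace (V n x) with (V n x / INR (S n) * INR (S n)) by (field; lra).
    assert (/ 4 < V n x / INR (S n)) by lra. nra. }
  assert (Hlim : Un_cv (fun m => mu (W m)) (mu (fun x => exists m, W m x))).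
  { apply (prob_continuity circle_sets mu HP); auto. intros m x H n Hn; apply H; lia. }
  destruct (Hlim (/ 4)) as [m Hm]; [lra|]. specialize (Hm m ltac:(lia)).
  unfold Rdist in Hm; apply Rabs_def2 in Hm.
  (* Markov's inequality bounds [mu (W m)] by [(1 / 8) / (1 / 4) = 1 / 2], against the value above
     3/4 obtained from the limit. *)
  pose proof (prob_markov circle_sets mu HP (fun k x => E (x + b k)) (S m)
    ltac:(intros; apply circle_sets_shift; auto) (W m) (INR (S m) / 4) (HW m)
    ltac:(intros x Hx; apply (Hx m); lia)) as Hmk.
  assert (Hup : rsum (fun i => mu (fun x => W m x /\ E (x + b i))) (S m) <= INR (S m) * / 8).
  { rewrite <- rsum_const. apply rsum_le; intros i.
    eapply Rle_trans; [|apply HmuE]. rewrite <- (rotation_invariant M mu Hrot E (b i)) by auto.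
    apply (prob_mono circle_sets mu HP); try tauto.
    - apply sigma_and; auto. apply circle_sets_shift; auto.
    - apply circle_sets_shift; auto. }
  assert (0 < INR (S m)) by (apply lt_0_INR; lia).
  nra.
Qed.

(** * Countability of the relations and of the exceptional parameters *)

Fixpoint encode_list {A : Type} (e : A -> nat) (l : list A) : nat :=
  match l with nil => O | x :: l' => S (Cantor.to_nat (e x, encode_list e l')) end.

Lemma to_nat_injective m n p q :
  Cantor.to_nat (m, n) = Cantor.to_nat (p, q) -> m = p /\ n = q.
Proof.
  intros H. apply (f_equal Cantor.of_nat) in H. rewrite !Cantor.cancel_of_to in H.
  now injection H.
Qed.

Lemma encode_list_injective {A : Type} (e : A -> nat) : (forall x y, e x = e y -> x = y) ->
  forall l l', encode_list e l = encode_list e l' -> l = l'.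
Proof.
  intros He; induction l; intros [|y l'] H; cbn [encode_list] in H; try discriminate; auto.
  apply Nat.succ_inj in H. apply to_nat_injective in H as [H1 H2].
  f_equal; auto.
Qed.

Definition encode_Z (z : Z) : nat := Cantor.to_nat (Z.to_nat z, Z.to_nat (- z)).

Lemma encode_Z_injective x y : encode_Z x = encode_Z y -> x = y.
Proof. unfold encode_Z; intros H; apply to_nat_injective in H; lia. Qed.

(** Coefficient vectors are stored as lists because these, unlike functions on [nat], can be encoded
    as natural numbers. *)
Definition coeff (l : list Z) (k : nat) : Z := nth k l 0%Z.

Definition nontrivial (l : list Z) : Prop := exists k, (k < length l)%nat /\ coeff l k <> 0%Z.

Definition list_comb (b : nat -> R) (l : list Z) : R := int_comb b (coeff l) (length l).

Lemma list_comb_of_function b z K k : (k < K)%nat -> z k <> 0%Z ->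
  exists l, nontrivial l /\ list_comb b l = int_comb b z K.
Proof.
  intros Hk Hz. set (l := map z (seq 0 K)).
  assert (Hlen : length l = K) by (unfold l; rewrite length_map, length_seq; auto).
  assert (Hco : forall i, (i < K)%nat -> coeff l i = z i).
  { intros i Hi. unfold coeff, l. rewrite (nth_indep _ 0%Z (z 0%nat)) by (rewrite length_map, length_seq; auto).
    rewrite map_nth, seq_nth; auto. }
  exists l; split.
  - exists k. rewrite Hlen, Hco; auto.
  - unfold list_comb. rewrite Hlen. apply int_comb_ext; auto.
Qed.

Lemma int_comb_scal c b z K : int_comb (fun k => c * b k) z K = c * int_comb b z K.
Proof. induction K; cbn [int_comb]; [ring|rewrite IHK; ring]. Qed.

(** Without a relation every nontrivial combination [c l] is nonzero. Any [x] outside the countable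
    set of quotients [IZR w / c l] makes 1 and the multiples [x * a (S k)] independent, which
    contradicts goodness. *)
Lemma good_has_relation M mu a : rotation_measure M mu -> pointwise_good a ->
  exists l, nontrivial l /\ list_comb (fun k => a (S k)) l = 0.
Proof.
  intros Hrot Hgood. apply NNPP; intro Hno.
  set (c := list_comb (fun k => a (S k))) in *.
  assert (Hc : forall l, nontrivial l -> c l <> 0) by (intros l Hl E; apply Hno; eauto).
  set (code := fun (l : list Z) (w : Z) => Cantor.to_nat (encode_list encode_Z l, encode_Z w)).
  (* Injectivity of [code] makes the described value unique when [n] is a code; elsewhere [v n] is
     arbitrary. *)
  set (v := fun n => epsilon (inhabits 0) (fun x => exists l w, code l w = n /\ x = IZR w / c l)).
  destruct (reals_not_enumerable M mu Hrot v) as [x Hx].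
  assert (Hbad : forall l w, nontrivial l -> x * c l <> IZR w).
  { intros l w Hl E. specialize (Hc l Hl).
    apply (Hx (code l w)). unfold v.
    destruct (epsilon_spec (inhabits 0) (fun x => exists l' w', code l' w' = code l w /\ x = IZR w' / c l'))
      as (l' & w' & Hcode & Heq); [eauto|].
    rewrite Heq. unfold code in Hcode. apply to_nat_injective in Hcode as [H1 H2].
    apply (encode_list_injective _ encode_Z_injective) in H1.
    apply encode_Z_injective in H2. subst. rewrite <- E. field; auto. }
  assert (Hx0 : x <> 0).
  { intros ->. apply (Hbad (1%Z :: nil) 0%Z).
    - exists 0%nat; split; simpl; [lia|discriminate].
    - ring. }
  (* The speed must be positive; a change of sign of [x] is absorbed by replacing [w] with its
     opposite. *)
  apply (independent_not_pointwise_good M mu a (Rabs x) Hrot); auto.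
  { apply Rabs_pos_lt; auto. }
  intros K z w E k Hk. apply NNPP; intro Hz.
  rewrite int_comb_scal in E.
  destruct (list_comb_of_function (fun k => a (S k)) z K k Hk Hz) as (l & Hl & Hlc).
  fold c in Hlc. rewrite <- Hlc in E.
  unfold Rabs in E. destruct Rcase_abs.
  - apply (Hbad l (- w)%Z Hl). rewrite opp_IZR. lra.
  - apply (Hbad l w Hl E).
Qed.

Lemma rational_interval_inside u d : 0 < d -> exists (n : nat) (p q : Z),
  u - d < IZR p / INR (S n) < u /\ u < IZR q / INR (S n) < u + d.
Proof.
  intros Hd. destruct (INR_unbounded (2 / d)) as [n Hn].
  assert (Hn0 : 0 < INR (S n)) by (apply lt_0_INR; lia).
  assert (Hnd : 2 < d * INR (S n)).
  { apply Rmult_lt_compat_l with (r := d) in Hn; auto.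
    replace (d * (2 / d)) with 2 in Hn by (field; lra). rewrite S_INR; lra. }
  destruct (frac_part_exists (u * INR (S n))) as [i Hi].
  exists n, (i - 1)%Z, (i + 1)%Z. rewrite minus_IZR, plus_IZR.
  assert (H : forall y, (y < u * INR (S n) -> y / INR (S n) < u) /\
    (u * INR (S n) < y -> u < y / INR (S n)) /\ ((u - d) * INR (S n) < y -> u - d < y / INR (S n)) /\
    (y < (u + d) * INR (S n) -> y / INR (S n) < u + d)).
  { intros y. repeat split; intros H; apply Rmult_lt_reg_r with (INR (S n)); auto;
     replace (y / INR (S n) * INR (S n)) with y by (field; lra); auto. }
  split; split; apply H; lra.
Qed.

(** If [f] is not a polynomial, each good [u] is an isolated zero of [g l] for some nontrivial [l].
    The list [l] and a rational interval isolating [u] determine [u], so the good parameters inject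
    into [nat]. *)
Lemma uncountable_good_polynomial M mu f : rotation_measure M mu ->
  real_analytic_on_nonneg f ->
  uncountable (fun u => 0 < u /\ pointwise_good (fun k => f (INR k * u))) ->
  is_polynomial_on_nonneg f.
Proof.
  intros Hrot Hf Hunc. apply NNPP; intro Hnp. apply Hunc; clear Hunc.
  set (g := fun l u => list_comb (fun k => f (INR (S k) * u)) l).
  set (P := fun u (t : list Z * (nat * (Z * Z))) => let '(l, (n, (p, q))) := t in
    g l u = 0 /\ IZR p / INR (S n) < u < IZR q / INR (S n) /\
    forall x, IZR p / INR (S n) < x < IZR q / INR (S n) -> g l x = 0 -> x = u).
  assert (Hex : forall u, 0 < u -> pointwise_good (fun k => f (INR k * u)) -> exists t, P u t).
  { intros u Hu Hg.
    destruct (good_has_relation M mu _ Hrot Hg) as (l & Hl & Hrel).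
    destruct (analytic_dichotomy (g l) u) as [Hv|(d & Hd & Hiso)]; [lra| | |].
    - apply analytic_int_comb; [exact Hf|lra].
    - exfalso; apply Hnp.
      apply (relation_forces_polynomial f (coeff l) (length l) u Hf Hl); [lra|exact Hv].
    (* Radius at most [u] keeps the interval in the domain of analyticity; radius at most [d]
       excludes other zeros. *)
    - destruct (rational_interval_inside u (Rmin u d)) as (n & p & q & Hp & Hq); [apply Rmin_pos; auto|].
      pose proof (Rmin_l u d); pose proof (Rmin_r u d).
      exists (l, (n, (p, q))); split; [exact Hrel|split; [lra|]].
      intros x Hx Hgx. apply NNPP; intro Hne. apply (Hiso x); auto; [lra|].
      apply Rabs_def1; lra. }
  set (enc := fun t : list Z * (nat * (Z * Z)) => let '(l, (n, (p, q))) := t in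
    Cantor.to_nat (encode_list encode_Z l, Cantor.to_nat (n, Cantor.to_nat (encode_Z p, encode_Z q)))).
  assert (Henc : forall t t', enc t = enc t' -> t = t').
  { intros (l & n & p & q) (l' & n' & p' & q') H.
    unfold enc in H.
    apply to_nat_injective in H as [H1 H].
    apply to_nat_injective in H as [H2 H].
    apply to_nat_injective in H as [H3 H4].
    apply (encode_list_injective _ encode_Z_injective) in H1.
    apply encode_Z_injective in H3, H4. congruence. }
  exists (fun u => enc (epsilon (inhabits (nil, (0%nat, (0%Z, 0%Z)))) (P u))).
  intros u v [Hu Hgu] [Hv Hgv] H. apply Henc in H.
  pose proof (epsilon_spec (inhabits (nil, (0%nat, (0%Z, 0%Z)))) (P u) (Hex u Hu Hgu)) as H1.
  pose proof (epsilon_spec (inhabits (nil, (0%nat, (0%Z, 0%Z)))) (P v) (Hex v Hv Hgv)) as H2.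
  rewrite H in H1. destruct (epsilon _ (P v)) as (l & n & p & q).
  destruct H1 as (H1 & H1' & _), H2 as (_ & _ & H2). apply H2; auto.
Qed.

Theorem theorem1 (f : R -> R) :
  real_analytic_on_nonneg f ->
  uncountable (fun u => 0 < u /\ pointwise_good (fun k => f (INR k * u))) ->
  is_polynomial_on_nonneg f.
Proof.
  exact (uncountable_good_polynomial _ _ f Lebesgue.lebesgue_rotation_measure).
Qed.
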